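(* Let $t=2t'$ be a given even positive integer, let $\alpha$ be a given $t$-core self-conjugate partition, let $u',v'$ be nonnegative integers, and let $j_u,k_u$ ($1\le u\le u'$) and $j'_v,k'_v$ ($1\le v\le v'$) be nonnegative integers. Then there exists some $r\in\mathbb{N}$ such that $$D_t^r\Biggl(G_\lambda\Biggl(\prod_{u=1}^{u'}\sum_{\substack{\square\in\lambda\\ h_\square\equiv\pm j_u\ (\mathrm{mod}\ t)}}h_\square^{2k_u}\Biggr)\Biggl(\prod_{v=1}^{v'}\sum_{\substack{\square\in\lambda\\ c_\square\equiv j'_v\ (\mathrm{mod}\ t)}}c_\square^{k'_v}\Biggr)\Biggr)=0$$ for every self-conjugate partition $\lambda$ with $\lambda_{t\text{-core}}=\alpha$. Furthermore, for any given self-conjugate partition $\mu$, $$\sum_{\substack{\lambda\in\mathcal{SC},\ \lambda\ge_t\mu\\ |\lambda/\mu|=2nt}}F_{\lambda/\mu}\,G_\lambda\Biggl(\prod_{u=1}^{u'}\sum_{\substack{\square\in\lambda\\ h_\square\equiv\pm j_u\ (\mathrm{mod}\ t)}}h_\square^{2k_u}\Biggr)\Biggl(\prod_{v=1}^{v'}\sum_{\substack{\square\in\lambda\\ c_\square\equiv j'_v\ (\mathrm{mod}\ t)}}c_\square^{k'_v}\Biggr)$$ is a polynomial in $n$ of degree at most $\sum_{u=1}^{u'}(k_u+1)+\sum_{v=1}^{v'}\frac{k'_v+2}{2}$.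
   Context: Partitions are identified with Young diagrams (boxes $(i,j)$, row $i$, column $j$, $1\le j\le\lambda_i$); $h_\square$ is the usual hook length and $c_\square=j-i$ the content of a box $\square=(i,j)$ of $\lambda$; $H(\lambda)$ is the product of all hook lengths; $|\lambda|$ is the size, $|\lambda/\mu|=|\lambda|-|\mu|$; the convention $0^0=1$ is used. A condition $h\equiv\pm j$ means $h\equiv j$ or $h\equiv-j$, each box being counted once. $\mathcal{SC}$ is the set of self-conjugate partitions. Littlewood decomposition. Encode a partition $\lambda$ by the bi-infinite binary word of its boundary (English convention), read from bottom-left to top-right with each vertical edge coded $0$ and each horizontal edge coded $1$ (so it begins with infinitely many $0$'s and ends with infinitely many $1$'s), indexed as $(a_i)_{i\in\mathbb{Z}}$ so that $\#\{i\le-1:a_i=1\}=\#\{i\ge0:a_i=0\}$. For $0\le i\le t-1$, $\lambda^i$ is the partition encoded by the word $(a_{tk+i})_{k\in\mathbb{Z}}$ (up to a shift of index), and $\lambda_{t\text{-core}}$ is the $t$-core (partition with no hook length equal to $t$) obtained by rearranging, within each residue class mod $t$, the word so that all $0$'s precede all $1$'s (keeping, in each class, $\#\{k\ge0:0\}-\#\{k<0:1\}$ unchanged). For $t=2t'$ even, this identifies $\lambda\in\mathcal{SC}$ with $(\lambda_{t\text{-core}};\lambda^0,\dots,\lambda^{t-1})$ where $\lambda_{t\text{-core}}$ is a self-conjugate $t$-core and $\lambda^i$ is the conjugate of $\lambda^{t-1-i}$; hence $\lambda$ is in bijective correspondence with $(\lambda_{t\text{-core}};\lambda^0,\dots,\lambda^{t'-1})$,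 with $\lambda^0,\dots,\lambda^{t'-1}$ arbitrary partitions. For self-conjugate $\lambda,\mu$ write $\lambda\ge_t\mu$ if $\lambda_{t\text{-core}}=\mu_{t\text{-core}}$ and $\lambda^i\supseteq\mu^i$ for $0\le i\le t'-1$. Define $F_{\mu/\mu}=1$ and, for $\lambda\ge_t\mu$ with $\lambda\ne\mu$, $F_{\lambda/\mu}=\sum F_{\lambda^-/\mu}$, the sum over $\lambda^-\in\mathcal{SC}$ with $\lambda\ge_t\lambda^-\ge_t\mu$ and $|\lambda/\lambda^-|=2t$. Put $$G_\lambda=\frac{2^{N}}{t^{N}\prod_{i=0}^{t'-1}H(\lambda^i)},\qquad N=\sum_{i=0}^{t'-1}|\lambda^i|.$$ For a function $g$ of self-conjugate partitions, $D_tg(\lambda)=\sum_{\lambda^+}g(\lambda^+)-g(\lambda)$, the sum over $\lambda^+\in\mathcal{SC}$ with $\lambda^+\ge_t\lambda$ and $|\lambda^+/\lambda|=2t$; $D_t^0g=g$, $D_t^kg=D_t(D_t^{k-1}g)$. *)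

(* Defs.v *)
From HB Require Import structures.
From mathcomp Require Import all_boot all_order all_algebra.
From mathcomp Require Import zify.

Set Implicit Arguments.
Unset Strict Implicit.
Unset Printing Implicit Defensive.

Import Order.TTheory GRing.Theory Num.Theory.

(* A partition is a weakly decreasing sequence of positive naturals; its size
   is [sumn].  Rows and columns are numbered from 0, which changes neither
   contents nor hook lengths. *)
Definition is_part (s : seq nat) : bool := sorted geq s && (0 \notin s).

Definition conj_part (s : seq nat) : seq nat :=
  [seq count (fun p => j < p) s | j <- iota 0 (head 0 s)].

Definition self_conj (s : seq nat) : bool := is_part s && (conj_part s == s).

Definition boxes (s : seq nat) : seq (nat * nat) :=
  [seq (i, j) | i <- iota 0 (size s), j <- iota 0 (nth 0 s i)].

Definition hook (s : seq nat) (b : nat * nat) : nat :=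
  ((nth 0 s b.1 - b.2.+1) + (nth 0 (conj_part s) b.2 - b.1.+1)).+1.

Definition content (b : nat * nat) : int := (b.2%:Z - b.1%:Z)%R.

Definition hook_product (s : seq nat) : nat := \prod_(b <- boxes s) hook s b.

Definition is_core (t : nat) (s : seq nat) : bool :=
  all (fun b => hook s b != t) (boxes s).

Definition sub_part (s' s : seq nat) : bool :=
  all (fun i => nth 0 s' i <= nth 0 s i) (iota 0 (size s')).

Fixpoint parts_rec (fuel m n : nat) : seq (seq nat) :=
  if n == 0 then [:: [::]]
  else if fuel is f.+1 then
    flatten [seq [seq p :: s | s <- parts_rec f p (n - p)]
            | p <- iota 1 (minn m n)]
  else [::].

Definition partitions_of (n : nat) : seq (seq nat) := parts_rec n n n.

Lemma mem_parts_rec fuel m n s : n <= fuel ->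
  (s \in parts_rec fuel m n) = [&& is_part s, head 0 s <= m & sumn s == n].
Proof.
elim: fuel m n s => [|f IH] m n s le_nf /=.
  move: le_nf; rewrite leqn0 => /eqP-> /=; rewrite inE.
  by case: s => [|[|p] s]; rewrite /is_part //= ?inE /= ?andbF.
case: eqP => [->|/eqP n_neq0].
  by rewrite inE; case: s => [|[|p] s]; rewrite /is_part //= ?inE /= ?andbF.
apply/flattenP/and3P => [[_ /mapP[p p_in ->] /mapP[s' s'_in ->]]|[]].
  move: p_in s'_in; rewrite mem_iota add1n ltnS leq_min.
  move=> /andP[p_gt0 /andP[le_pm le_pn]]; rewrite IH; last lia.
  case/and3P=> /andP[srt s0] hd /eqP sm; split; rewrite //= ?sm ?subnKC //.
  rewrite /is_part inE negb_or s0 eq_sym -lt0n p_gt0 !andbT /=.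
  by case: s' hd srt {s0 sm} => //= q s' ->.
case: s => [|p s] /=; first by move=> _ _; rewrite eq_sym (negPf n_neq0).
rewrite /is_part inE negb_or => /andP[srt /andP[p0 s0]] le_pm /eqP sm.
exists [seq p :: s0 | s0 <- parts_rec f p (n - p)].
  by apply: map_f; rewrite mem_iota; lia.
apply: map_f; rewrite IH; last lia.
apply/and3P; split; first by rewrite /is_part (path_sorted srt).
- by case: s srt {s0 sm} => //= q s /andP[].
- by rewrite -sm addKn.
Qed.

Lemma mem_partitions_of n s :
  (s \in partitions_of n) = is_part s && (sumn s == n).
Proof.
rewrite mem_parts_rec //; case: eqP => [<-|]; rewrite ?andbF // !andbT.
by case: s => [|p s] //=; rewrite leq_addr andbT.
Qed.

Lemma uniq_partitions_of n : uniq (partitions_of n).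
Proof.
suff gen f m k : uniq (parts_rec f m k) by exact: gen.
elim: f m k => [|f IH] m k /=.
  by case: (k == 0).
case: (k == 0) => //.
elim: (iota 1 _) (iota_uniq 1 (minn m k)) => //= p l IHl /andP[pl ul].
rewrite cat_uniq IHl // map_inj_uniq ?IH ?andbT //=; last by move=> x y [].
apply/hasPn => _ /flattenP[_ /mapP[q ql ->] /mapP[s _ ->]].
by apply/mapP=> -[s' _ [eq_qp _]]; rewrite -eq_qp ql in pl.
Qed.

(* The part of the boundary of [s] between the two axes, read from bottom-left
   to top-right: [true] is a horizontal edge (1), [false] a vertical edge (0). *)
Fixpoint rim (s : seq nat) : seq bool :=
  if s is p :: s' then rim s' ++ rcons (nseq (p - head 0 s') true) false
  else [::].

(* The bi-infinite boundary word (a_k).  Since [rim s] has exactly [size s]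
   vertical edges, starting it at index - size s is the normalisation for which
   as many 1's occur at indices < 0 as 0's at indices >= 0. *)
Definition bword (s : seq nat) (k : int) : bool :=
  let m := (k + (size s)%:Z)%R in
  if (m < 0)%R then false else nth true (rim s) `|m|%N.

(* The partition encoded by the finite word [w] preceded by 0's and followed by
   1's: each 0 is a row, as long as the number of 1's before it. *)
Definition decode (w : seq bool) : seq nat :=
  rev [seq p <- [seq count id (take i w) | i <- iota 0 (size w) & ~~ nth true w i]
      | 0 < p].

Definition window (a : int -> bool) (K : nat) : seq bool :=
  [seq a (k%:Z - K%:Z)%R | k <- iota 0 (K + K)].

(* All entries of [bword s] are 0 below - extent s and 1 from extent s on;
   for t > 0 and i < t the same holds of the subword of indices t k + i. *)
Definition extent (s : seq nat) : nat := size s + head 0 s.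

Definition subword (t : nat) (s : seq nat) (i : nat) (k : int) : bool :=
  bword s (t%:Z * k + i%:Z)%R.

Definition quotient (t : nat) (s : seq nat) (i : nat) : seq nat :=
  decode (window (subword t s i) (extent s)).

Definition charge (t : nat) (s : seq nat) (i : nat) : int :=
  ((\sum_(0 <= k < extent s) ~~ subword t s i k%:Z)%N%:Z
   - (\sum_(0 <= k < extent s) subword t s i (- k.+1%:Z)%R)%N%:Z)%R.

(* Rearranging each residue class so that the 0's precede the 1's, with
   unchanged charge c, puts 0 at index t k + i exactly when k < c. *)
Definition core_word (t : nat) (s : seq nat) (m : int) : bool :=
  (charge t s `|(m %% t%:Z)%Z|%N <= (m %/ t%:Z)%Z)%R.

Definition core (t : nat) (s : seq nat) : seq nat :=
  decode (window (core_word t s) (t * extent s)).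

Definition ge_t (t : nat) (s s' : seq nat) : bool :=
  (core t s == core t s')
  && all (fun i => sub_part (quotient t s' i) (quotient t s i)) (iota 0 t./2).

(* Each step removes 2t > 0 boxes, so [sumn s] is enough fuel. *)
Fixpoint F_rec (fuel t : nat) (s s' : seq nat) : nat :=
  if s == s' then 1
  else if fuel is f.+1 then
    \sum_(r <- partitions_of (sumn s - 2 * t)
          | [&& self_conj r, sumn s == sumn r + 2 * t, ge_t t s r & ge_t t r s'])
      F_rec f t r s'
  else 0.

Definition F (t : nat) (s s' : seq nat) : nat := F_rec (sumn s) t s s'.

Local Open Scope ring_scope.

Definition G (t : nat) (s : seq nat) : rat :=
  let N := (\sum_(0 <= i < t./2) sumn (quotient t s i))%N in
  2%:R ^+ N
  / (t%:R ^+ N * \prod_(0 <= i < t./2) (hook_product (quotient t s i))%:R).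

Definition Dt (t : nat) (g : seq nat -> rat) (s : seq nat) : rat :=
  \sum_(r <- partitions_of (sumn s + 2 * t) | self_conj r && ge_t t r s) g r
  - g s.

Definition hook_sum (t j k : nat) (s : seq nat) : rat :=
  \sum_(b <- boxes s | ((hook s b)%:Z == j%:Z %[mod t%:Z])%Z
                       || ((hook s b)%:Z == - j%:Z %[mod t%:Z])%Z)
     (hook s b)%:R ^+ (2 * k).

Definition content_sum (t j k : nat) (s : seq nat) : rat :=
  \sum_(b <- boxes s | (content b == j%:Z %[mod t%:Z])%Z)
     (content b)%:~R ^+ k.

Definition summand (t u' v' : nat) (j k : 'I_u' -> nat) (j' k' : 'I_v' -> nat)
    (s : seq nat) : rat :=
  G t s * (\prod_(u < u') hook_sum t (j u) (k u) s)
        * (\prod_(v < v') content_sum t (j' v) (k' v) s).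

(* Main.v *)
(* Encode a partition by the positions of the 0's of its boundary word: a hook is a
   pair (1 at x, 0 at y) with x < y, and adding a box to a component of the
   quotient moves one 0 from x to x + t (and its mirror image likewise).  In terms
   of the signed sums L_i(f) of f over class i (0's at nonnegative positions minus
   1's at negative ones) the content sums are linear and, since h^(2k) is even, the
   hook sums are quadratic.  Give L_i(f) the weight deg f + 1; then the two kinds of
   factors have weights k' + 2 and 2k + 2.
   The ratios G(la+)/G(la) are the probabilities of a random growth: a uniform
   class i < t/2, then the Plancherel growth of the quotient.  These probabilities
   are the residues of prod (z - y) / prod (z - x), so that the moments of the moving
   position are found recursively from the logarithmic derivative and the d-th one
   has weight d.  A move changes L_i(f) by a polynomial in the position of degree
   deg f - 1, so D_t (G g) = G g' with g' of weight at least 2 less than g.  Hence D_t is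
   nilpotent on the functions considered, and the sum over the n-th level is
   (1 + D_t)^n (G g) at mu, a polynomial in n of degree at most half the weight. *)

(* The loss of weight 2 comes from two sources. A 0 moving from k to k + 1 replaces a class sum of f
   by f(k + 1) - f(k): one degree is lost by taking the difference, and the extra 1 in the weight of
   a class sum is lost because a value at one position takes the place of a sum. Averaging over k
   then costs nothing: in the recursion d M_d = sum_m K_m M_(d - m) for the moments, K_m is, up to a
   constant, the signed sum of x^m - (x - 1)^m, and degree m - 1 means weight m. The words are
   infinite on both sides, so sums are taken relative to the empty partition and products inside a
   finite window, whose size must disappear from the results. In the ratio of hook products one
   boundary factor survives; it cancels against the lowest 0 of the window, the one that has no
   counterpart among the y's. Each class is the word of its quotient displaced by a charge. The
   charges carry the same information as the core and do not change during the growth, so positions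
   in the displaced words can serve as coordinates throughout, and every later statement about words
   allows for such a shift. *)
Require Import Defs.
From mathcomp Require Import all_boot all_order all_algebra.
From mathcomp Require Import zify ring.

Set Implicit Arguments.
Unset Strict Implicit.
Unset Printing Implicit Defensive.

Import Order.TTheory GRing.Theory Num.Theory.
Local Open Scope ring_scope.

(** * Partitions and boundary words *)

(* The vertical edges of the boundary, from right to left; the remaining
   positions of the boundary word are horizontal edges. *)
Definition zpos (s : seq nat) (i : nat) : int := (nth 0%N s i)%:Z - i.+1%:Z.

Lemma part_nth_le s i j : is_part s -> (i <= j)%N ->
  (nth 0 s j <= nth 0 s i)%N.
Proof.
case/andP=> srt _ le_ij; have [lt_j|ge_j] := ltnP j (size s); last first.
  by rewrite (nth_default _ ge_j).
by apply: (sorted_leq_nth (leT := geq) _ _ 0%N srt) => //= [x y z|x|];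
  rewrite ?inE /=; lia.
Qed.

Lemma part_nth_gt0 s i : is_part s -> (0 < nth 0 s i)%N = (i < size s)%N.
Proof.
case/andP=> _ s0; case: (ltnP i (size s)) => [lt_i|ge_i]; last by rewrite nth_default.
by rewrite lt0n; apply: contraNneq s0 => <-; exact: mem_nth.
Qed.

Lemma is_part_cons p s : is_part (p :: s) = [&& (0 < p)%N, (head 0 s <= p)%N & is_part s].
Proof.
rewrite /is_part [0%N \in p :: s]inE negb_or lt0n [p == 0%N]eq_sym.
by case: s => [|q s] /=; case: (0%N == p); rewrite ?andbF ?andbT //= andbA.
Qed.

Lemma part_ext s s' : is_part s -> is_part s' ->
  (forall i, nth 0%N s i = nth 0%N s' i) -> s = s'.
Proof.
move=> ps ps' E.
have sz i : (i < size s)%N = (i < size s')%N by rewrite -!part_nth_gt0 ?E.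
by apply: (@eq_from_nth _ 0%N) => // ; have := sz (size s); have := sz (size s'); lia.
Qed.

Lemma zpos_lt s i j : is_part s -> (i < j)%N -> zpos s j < zpos s i.
Proof.
move=> ps lt_ij; rewrite /zpos; have := part_nth_le ps (ltnW lt_ij); lia.
Qed.

Lemma size_rim s : is_part s -> size (rim s) = (size s + head 0 s)%N.
Proof.
elim: s => //= p s IH; rewrite is_part_cons => /and3P[_ hp ps].
by rewrite size_cat size_rcons size_nseq IH //; lia.
Qed.

Lemma bword_nil k : bword [::] k = (0 <= k).
Proof.
by rewrite /bword /= addr0; case: ltrP => // k_ge0; rewrite nth_nil.
Qed.

Lemma bword_cons p s k : is_part (p :: s) ->
  bword (p :: s) k = (k != p%:Z - 1) && bword s (k + 1).
Proof.
move=> pps; have := pps; rewrite is_part_cons => /and3P[p0 hp ps].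
rewrite /bword; have -> : (k + (size (p :: s))%:Z)%R = k + 1 + (size s)%:Z by rewrite /=; lia.
case: ltrP => [|m_ge0]; first by rewrite andbF.
case Em: (k + 1 + _) m_ge0 => [m|//] _.
rewrite /= nth_cat size_rim //; case: ltnP => [lt_m|ge_m].
  by have -> : k != p%:Z - 1 by lia.
rewrite nth_rcons size_nseq nth_nseq if_same (nth_default true (s := rim s)) ?size_rim //.
rewrite andbT; case: ltnP => [|ge]; first lia.
by case: eqP => E; lia.
Qed.

Lemma bwordP s k : is_part s -> reflect (exists i, zpos s i = k) (~~ bword s k).
Proof.
elim: s k => [|p s IH] k ps.
  rewrite bword_nil -ltNge; apply: (iffP idP) => [k_lt0|[i <-]].
    by exists (absz (k + 1)); rewrite /zpos nth_nil; lia.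
  by rewrite /zpos nth_nil; lia.
rewrite bword_cons // negb_and negbK; move: ps; rewrite is_part_cons => /and3P[_ _ ps].
apply: (iffP orP) => [[/eqP->|/(IH _ ps)[i Ei]]|[[|i] Ei]].
- by exists 0%N.
- by exists i.+1; rewrite /zpos /= -[k](addrK 1) -Ei /zpos; lia.
- by left; rewrite -Ei.
- by right; apply/(IH _ ps); exists i; rewrite -Ei /zpos /=; lia.
Qed.

Lemma bword_zpos s i : is_part s -> bword s (zpos s i) = false.
Proof. by move=> ps; apply/negbTE/bwordP => //; exists i. Qed.

Lemma bword_low s k : is_part s -> k < - (size s)%:Z -> bword s k = false.
Proof.
move=> ps lt_k; apply/negbTE/bwordP => //.
by exists (absz (k + 1)); rewrite /zpos nth_default; lia.
Qed.

Lemma bword_high s k : is_part s -> (head 0%N s)%:Z <= k -> bword s k.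
Proof.
move=> ps le_k; apply/negPn/negP => /(bwordP _ ps)[i Ei].
by have := part_nth_le ps (leq0n i); rewrite nth0; rewrite /zpos in Ei; lia.
Qed.

(** A strictly decreasing sequence is recovered from its range: the n-th value is the largest one
    not yet used. Hence the strong induction, with one inequality proved for an arbitrary pair and
    applied both ways. *)
Lemma decreasing_range_inj (f g : nat -> int) :
  (forall i j, (i < j)%N -> f j < f i) -> (forall i j, (i < j)%N -> g j < g i) ->
  (forall i, exists j, g j = f i) -> (forall i, exists j, f j = g i) -> f =1 g.
Proof.
move=> df dg fg gf; elim/ltn_ind => n IH.
suff le (h1 h2 : nat -> int) : (forall i j, (i < j)%N -> h1 j < h1 i) ->
    (forall i j, (i < j)%N -> h2 j < h2 i) -> (forall i, exists j, h2 j = h1 i) ->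
    (forall m, (m < n)%N -> h1 m = h2 m) -> h1 n <= h2 n.
  by apply/le_anti/andP; split; apply: le => // m /IH.
move=> d1 d2 h12 E; have [j Ej] := h12 n.
have [lt_j|] := ltnP j n; first by have := d1 _ _ lt_j; rewrite (E j) // Ej ltxx.
by rewrite -Ej leq_eqVlt => /predU1P[->//|/d2/ltW].
Qed.

(** The set of 0's determines both the rows and the displacement. This uniqueness is the tool that
    later identifies quotient and charge of a class at the same time. *)
Lemma bword_shift_inj s s' c c' : is_part s -> is_part s' ->
  (forall k, bword s (k - c) = bword s' (k - c')) -> s = s' /\ c = c'.
Proof.
move=> ps ps' E.
have sub u u' d d' i : is_part u -> is_part u' ->
    (forall k, bword u (k - d) = bword u' (k - d')) -> exists j, zpos u' j + d' = zpos u i + d.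
  move=> pu pu' Eu; have /(bwordP _ pu')[j Ej] : ~~ bword u' (zpos u i + d - d').
    by rewrite -Eu addrK bword_zpos.
  by exists j; rewrite Ej subrK.
have Ez i : zpos s i + c = zpos s' i + c'.
  apply: (decreasing_range_inj (f := fun i => zpos s i + c)
    (g := fun i => zpos s' i + c')) => [{}i j lt|{}i j lt|{}i|{}i].
  - by rewrite ltrD2r zpos_lt.
  - by rewrite ltrD2r zpos_lt.
  - exact: sub.
  - by apply: sub.
(* Past the ends of both partitions the rows are empty and the i-th 0 sits at -(i + 1) in either
   word, so only the shifts are compared. *)
have Ec : c = c'.
  have := Ez (size s + size s')%N.
  by rewrite /zpos !nth_default ?leq_addr ?leq_addl //; lia.
split=> //; apply: part_ext => // i; have := Ez i; rewrite /zpos Ec; lia.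
Qed.

Lemma bword_inj s s' : is_part s -> is_part s' -> bword s =1 bword s' -> s = s'.
Proof.
by move=> ps ps' E; have [] := @bword_shift_inj s s' 0 0 ps ps' => // k; rewrite !subr0.
Qed.

Lemma count_gt_nth s i j : is_part s ->
  (i < count (fun p => j < p) s)%N = (j < nth 0 s i)%N.
Proof.
elim: s i => [|p s IH] i; first by rewrite nth_nil.
rewrite is_part_cons => /and3P[_ hp ps] /=.
have le_q q : q \in s -> (q <= p)%N.
  move=> /(nthP 0%N)[r _ <-]; apply: leq_trans hp.
  by rewrite -nth0 part_nth_le.
have [lt_jp|le_pj] := ltnP j p; first by case: i => [|i]; rewrite ?lt_jp ?add1n // ltnS IH.
rewrite add0n (_ : count _ s = 0)%N; last first.
  by apply/eqP; rewrite -leqn0 leqNgt -has_count; apply/hasPn=> q /le_q; lia.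
case: i => [|i] /=; first lia.
have := part_nth_le ps (leq0n i); rewrite nth0; lia.
Qed.

Lemma nth_conj_part s j : is_part s ->
  nth 0%N (conj_part s) j = count (fun p => j < p)%N s.
Proof.
move=> ps; have [lt_j|ge_j] := ltnP j (head 0%N s).
  by rewrite (nth_map 0%N) ?size_iota // nth_iota.
rewrite nth_default ?size_map ?size_iota //; apply/esym/eqP.
by rewrite -leqn0 leqNgt count_gt_nth // nth0 -leqNgt.
Qed.

Lemma conj_nthP s i j : is_part s ->
  (i < nth 0%N (conj_part s) j)%N = (j < nth 0%N s i)%N.
Proof. by move=> ps; rewrite nth_conj_part // count_gt_nth. Qed.

Lemma size_conj s : size (conj_part s) = head 0%N s.
Proof. by rewrite size_map size_iota. Qed.

Lemma is_part_conj s : is_part s -> is_part (conj_part s).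
Proof.
move=> ps; apply/andP; split.
  apply/(sortedP 0%N) => i _; rewrite /geq /= leqNgt.
  apply/negP; rewrite conj_nthP // => lt.
  by move: (ltnn (nth 0%N (conj_part s) i)); rewrite conj_nthP //; lia.
apply/negP => /(nthP 0%N)[j]; rewrite size_conj => lt_j Ej.
by have := conj_nthP 0 j ps; rewrite Ej nth0 lt_j.
Qed.

(** Conjugation reflects the diagram in its diagonal, which reverses the word and exchanges vertical
    with horizontal edges; with this indexing the reflection is x -> -1 - x. *)
Lemma bword_conj s k : is_part s -> bword (conj_part s) k = ~~ bword s (-1 - k).
Proof.
move=> ps; have pc := is_part_conj ps; apply/idP/idP; last first.
  case/(bwordP _ ps)=> i Ei; apply/negPn/negP => /(bwordP _ pc)[j Ej].
  have := conj_nthP i j ps; rewrite /zpos in Ei Ej.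
  case: (ltnP j (nth 0%N s i)) => a b; lia.
apply: contraLR; rewrite negbK => bk.
(* Position -1 - k carries a 1, the foot of some column. The first row [i] whose 0 lies before it is
   the length of that column, and the column number is then -1 - k + i. *)
have [i [lt_i ge_i]] : exists i, zpos s i < -1 - k /\
    (forall i', (i' < i)%N -> -1 - k <= zpos s i').
  have ex : exists i, zpos s i < -1 - k.
    by exists (size s + `|k|).+1; rewrite /zpos nth_default; lia.
  exists (ex_minn ex); case: ex_minnP => i lt_i min_i; split=> // i' lt_i'.
  by rewrite leNgt; apply/negP => /min_i; lia.
have neq i' : zpos s i' != -1 - k.
  by apply: contraTneq bk => <-; rewrite bword_zpos.
apply/(bwordP _ pc).
have ge0 : 0 <= -1 - k + i%:Z.
  by move: lt_i; rewrite /zpos; lia.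
exists (absz (-1 - k + i%:Z)).
rewrite /zpos (_ : nth _ _ _ = i); first lia.
apply/eqP; rewrite eqn_leq; apply/andP; split.
  by rewrite leqNgt conj_nthP //; move: lt_i; rewrite /zpos; lia.
case: i lt_i ge_i ge0 => // i lt_i ge_i ge0.
rewrite conj_nthP //; have := ge_i i (ltnSn _); have := neq i; rewrite /zpos; lia.
Qed.

Lemma self_conj_part s : self_conj s -> is_part s.
Proof. by case/andP. Qed.

Lemma bword_self_conj s k : self_conj s -> bword s (-1 - k) = ~~ bword s k.
Proof. by case/andP=> ps /eqP E; rewrite -[in RHS]E bword_conj // negbK. Qed.

(* Conjugation maps a word to its reversed complement, so a word with that
   symmetry has charge 0 and decoding does not shift it. *)
Lemma symmetric_word s c (a : int -> bool) : is_part s ->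
  (forall k, bword s k = a (k + c)) -> (forall k, a (-1 - k) = ~~ a k) ->
  c = 0 /\ self_conj s.
Proof.
move=> ps E sym.
have [|Es Ec] := @bword_shift_inj (conj_part s) s 0 (c + c) (is_part_conj ps) ps.
  move=> k; rewrite bword_conj // !E -sym; congr a; lia.
by split; [lia | rewrite /self_conj ps Es eqxx].
Qed.

(** * Decoding finite words *)

Lemma decode_rcons w b : decode (rcons w b) =
  if b || (count id w == 0)%N then decode w else count id w :: decode w.
Proof.
rewrite /decode size_rcons -(addn1 (size w)) iotaD add0n filter_cat map_cat filter_cat /=.
rewrite !nth_rcons ltnn eqxx.
have -> : [seq i <- iota 0 (size w) | ~~ nth true (rcons w b) i]
        = [seq i <- iota 0 (size w) | ~~ nth true w i].
  by apply: eq_in_filter => i; rewrite mem_iota nth_rcons => /andP[_ ->].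
have -> : [seq count id (take i (rcons w b)) | i <- iota 0 (size w) & ~~ nth true w i]
        = [seq count id (take i w) | i <- iota 0 (size w) & ~~ nth true w i].
  apply/eq_in_map=> i; rewrite mem_filter mem_iota => /and3P[_ _ lt_i].
  by rewrite -cats1 takel_cat // ltnW.
case: b => /=; first by rewrite cats0.
rewrite -cats1 take_size_cat //.
rewrite lt0n; case: eqP => /= _; first by rewrite cats0.
by rewrite cats1 rev_rcons.
Qed.

(** Leading 0's of [w] give no rows but count in the shift; this is consistent, since they merge
    with the 0's preceding every boundary word. The bound on the head makes a new row of length
    [count id w] admissible in the induction. *)
Lemma decodeP w : [/\ is_part (decode w), (head 0 (decode w) <= count id w)%N &
  forall k, bword (decode w) k = let m := k + (count negb w)%:Z in
     if m < 0 then false else nth true w `|m|%N].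
Proof.
elim/last_ind: w => [|w b [pw hw bw]].
  split=> // k; rewrite bword_nil /= addr0; case: ltrP => //; by rewrite nth_nil.
rewrite decode_rcons -cats1 !count_cat /= !addn0.
have szw : size w = (count id w + count negb w)%N.
  by rewrite -(count_predC id).
case: b => /=.
  split=> //; first lia.
  move=> k; rewrite addn0 bw /=; case: ltrP => // _.
  rewrite nth_cat; case: ltnP => // ge_; rewrite [LHS]nth_default //.
  by case: (_ - _)%N => // n; rewrite nth_default.
case: eqP => [c0|/eqP c0].
  split=> //; first lia.
  move=> k; have c0' : count negb w = size w by rewrite szw c0.
  have -> : decode w = [::].
    by move: hw pw; rewrite c0; case: (decode w) => //= p s; rewrite is_part_cons; lia.
  rewrite bword_nil /= c0' -[[:: false]]/(nseq 1 false) (_ : w = nseq (size w) false); last first.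
    by apply/all_pred1P; rewrite all_count -c0'; apply/eqP/eq_count => -[].
  rewrite size_nseq -nseqD nth_nseq.
  case: ltrP => ?; first lia.
  by case: ltnP => ?; lia.
split=> /=.
- by rewrite is_part_cons pw lt0n c0 hw.
- by rewrite addn0.
move=> k; rewrite bword_cons ?is_part_cons ?pw ?lt0n ?c0 ?hw // bw /=.
rewrite (_ : k + (count negb w + 1)%N%:Z = k + 1 + (count negb w)%:Z); last lia.
case: ltrP => [|m_ge0]; first by rewrite andbF.
case Em: (k + 1 + _) m_ge0 => [m|//] _ /=.
rewrite nth_cat; case: ltnP => [lt_m|ge_m].
  by have -> : k != (count id w)%:Z - 1 by lia.
rewrite (nth_default _ ge_m) andbT; case: eqP => E; last first.
  by case: (m - size w)%N (subnKC ge_m) => [|d] ?; [lia | rewrite /= nth_nil].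
by rewrite (_ : (m - size w)%N = 0%N) //; lia.
Qed.

(** * Quotients and cores *)

Definition zr (K : nat) : seq int := [seq k%:Z - K%:Z | k <- iota 0 (K + K)].

Lemma mem_zr K x : (x \in zr K) = (- K%:Z <= x < K%:Z).
Proof.
apply/mapP/idP => [[k]|h]; first by rewrite mem_iota => ? ->; lia.
by exists (absz (x + K%:Z)); rewrite ?mem_iota; lia.
Qed.

Lemma uniq_zr K : uniq (zr K).
Proof. by rewrite map_inj_uniq ?iota_uniq // => x y; lia. Qed.

Definition vac_outside (a : int -> bool) (K : nat) :=
  forall x, (x < - K%:Z -> a x = false) /\ (K%:Z <= x -> a x).

Definition wcharge (a : int -> bool) (K : nat) : int :=
  (\sum_(0 <= k < K) ~~ a k%:Z)%N%:Z - (\sum_(0 <= k < K) a (- k.+1%:Z))%N%:Z.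

Lemma windowE a K : window a K = [seq a x | x <- zr K].
Proof. by rewrite /zr -map_comp. Qed.

Lemma count_window a K : (count negb (window a K))%:Z = wcharge a K + K%:Z.
Proof.
have -> : count negb (window a K) = (\sum_(0 <= k < K + K) ~~ a (k%:Z - K%:Z)%R)%N.
  by rewrite /window -sum1_count big_map big_mkcond /= /index_iota subn0.
rewrite (@big_cat_nat _ _ _ K) //= ?leq_addr // big_nat_rev /=.
have -> : (\sum_(K <= i < K + K) ~~ a (i%:Z - K%:Z)%R = \sum_(0 <= k < K) ~~ a k%:Z)%N.
  rewrite -{1}[K]add0n big_addn addnK.
  by apply: eq_bigr => i _; congr (nat_of_bool (~~ a _)); lia.
have key : (\sum_(0 <= i < K) ~~ a (((0 + K - i.+1)%N)%:Z - K%:Z)%R +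
    \sum_(0 <= k < K) a (- k.+1%:Z)%R = K)%N.
  rewrite -big_split /= -[RHS]muln1 -[in RHS](subn0 K) -sum_nat_const_nat.
  apply: eq_big_nat => i /andP[_ lt_i].
  by rewrite (_ : _ - _ = - i.+1%:Z); [case: (a _) | lia].
rewrite /wcharge; lia.
Qed.

Lemma wcharge_bound a K : - K%:Z <= wcharge a K <= K%:Z.
Proof.
have le_K (b : nat -> bool) : (\sum_(0 <= k < K) b k <= K)%N.
  rewrite -{2}[K]muln1 -{2}(subn0 K) -sum_nat_const_nat.
  by apply: leq_sum => i _; case: (b i).
rewrite /wcharge; have := le_K (fun k => ~~ a k%:Z); have := le_K (fun k => a (- k.+1%:Z)); lia.
Qed.

(** Decoding renormalises the index. The window contains [K] plus charge many 0's by [count_window],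
    so the displacement is exactly the charge. *)
Lemma decode_window a K : vac_outside a K ->
  is_part (decode (window a K)) /\
  forall k, bword (decode (window a K)) k = a (k + wcharge a K).
Proof.
move=> va; have [pw _ bw] := decodeP (window a K); split=> // k.
rewrite bw /= count_window.
have [lt|ge] := ltrP; first by rewrite (va _).1; lia.
rewrite windowE.
have [lt|ge'] := ltnP (absz (k + (wcharge a K + K%:Z))) (K + K).
  rewrite (nth_map 0) ?size_map ?size_iota // (nth_map 0%N) ?size_iota // nth_iota //.
  by congr a; lia.
rewrite nth_default ?size_map ?size_iota // (va _).2 //; lia.
Qed.

Lemma bword_vac s : is_part s -> vac_outside (bword s) (extent s).
Proof.
move=> ps x; rewrite /extent; split=> ?; first by rewrite bword_low //; lia.
by rewrite bword_high //; lia.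
Qed.

Lemma subword_vac t s i : is_part s -> (i < t)%N -> vac_outside (subword t s i) (extent s).
Proof.
move=> ps lt_i x; rewrite /subword; split=> ?.
  by apply: (bword_vac ps _).1; nia.
by apply: (bword_vac ps _).2; nia.
Qed.

Lemma chargeE t s i : charge t s i = wcharge (subword t s i) (extent s).
Proof. by []. Qed.

(** The Littlewood decomposition in the form used below: a class consists of a partition and a
    displacement, and [bword_shift_inj] makes this pair unique. *)
Lemma quotientP t s i : is_part s -> (i < t)%N ->
  is_part (quotient t s i) /\
  forall k, subword t s i k = bword (quotient t s i) (k - charge t s i).
Proof.
move=> ps lt_i; have [pq bq] := decode_window (subword_vac ps lt_i).
by split=> // k; rewrite bq -chargeE subrK.
Qed.

Lemma self_conj_sub_mirror t s i : self_conj s -> (i < t)%N -> 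
  forall k, subword t s (t - i.+1)%N k = ~~ subword t s i (-1 - k).
Proof.
move=> sc lt_i k; rewrite /subword -bword_self_conj //; congr bword; nia.
Qed.

Lemma self_conj_quotient t s i : self_conj s -> (i < t)%N ->
  quotient t s (t - i.+1)%N = conj_part (quotient t s i) /\
  charge t s (t - i.+1)%N = - charge t s i.
Proof.
move=> sc lt_i; have ps := self_conj_part sc.
have [p1 E1] := quotientP ps lt_i.
have [|p2 E2] := @quotientP t s (t - i.+1)%N ps; first lia.
apply: bword_shift_inj => // [|k]; first exact: is_part_conj.
rewrite -E2 self_conj_sub_mirror // E1 bword_conj //.
by congr (~~ bword _ _); lia.
Qed.

Lemma core_word_vac t s : is_part s -> (0 < t)%N ->
  vac_outside (core_word t s) (t * extent s)%N.
Proof.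
move=> ps t0 x.
have lt_m : (absz (x %% t%:Z)%Z < t)%N.
  have := ltz_pmod x (d := t%:Z); have := modz_ge0 x (d := t%:Z); lia.
have := wcharge_bound (subword t s (absz (x %% t%:Z)%Z)) (extent s).
rewrite -chargeE /core_word => /andP[ge_c le_c].
have := divz_eq x t%:Z; have := ltz_pmod x (d := t%:Z); have := modz_ge0 x (d := t%:Z).
by split=> ?; [apply/negbTE; rewrite -ltNge|]; nia.
Qed.

Lemma core_word_split t s i q : (i < t)%N ->
  core_word t s (q * t%:Z + i%:Z) = (charge t s i <= q).
Proof.
move=> lt_i; rewrite /core_word modzMDl modz_small; last lia.
by rewrite divzMDl ?divz_small ?addr0 //; lia.
Qed.

Lemma core_word_mirror t s k : self_conj s -> (0 < t)%N ->
  core_word t s (-1 - k) = ~~ core_word t s k.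
Proof.
move=> sc t0.
have lt_m : (absz (k %% t%:Z)%Z < t)%N.
  have := ltz_pmod k (d := t%:Z); have := modz_ge0 k (d := t%:Z); lia.
have Ek : k = (k %/ t%:Z)%Z * t%:Z + (absz (k %% t%:Z)%Z)%:Z.
  have := divz_eq k t%:Z; have := modz_ge0 k (d := t%:Z); lia.
move: (absz _) (k %/ _)%Z lt_m Ek => m q lt_m ->.
rewrite (_ : -1 - _ = (-1 - q) * t%:Z + (t - m.+1)%N%:Z); last nia.
rewrite !core_word_split //; last lia.
by have [_ ->] := self_conj_quotient sc lt_m; lia.
Qed.

Lemma coreP t s : self_conj s -> (0 < t)%N ->
  self_conj (core t s) /\ bword (core t s) =1 core_word t s.
Proof.
move=> sc t0; have ps := self_conj_part sc.
have [pc bc] := decode_window (core_word_vac ps t0).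
have [E sc'] := symmetric_word pc bc (fun k => core_word_mirror k sc t0).
by split=> // k; rewrite bc E addr0.
Qed.

(** In each class the core word is a step function that jumps at the charge, so core and charges
    determine each other. Growth steps can then be analysed through charges. *)
Lemma core_eqP t s s' : self_conj s -> self_conj s' -> (0 < t)%N ->
  core t s = core t s' <-> forall i, (i < t)%N -> charge t s i = charge t s' i.
Proof.
move=> sc sc' t0; have [c1 b1] := coreP sc t0; have [c2 b2] := coreP sc' t0.
split=> [E i lt_i|E]; last first.
  apply: bword_inj => [||k]; try exact: self_conj_part.
  rewrite b1 b2 /core_word E //.
  have := ltz_pmod k (d := t%:Z); have := modz_ge0 k (d := t%:Z); lia.
have cE k : (charge t s i <= k) = (charge t s' i <= k).
  by rewrite -!core_word_split // -b1 -b2 E.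
by apply/eqP; rewrite eq_le cE lexx -cE lexx.
Qed.

(** * Sums over boxes and hooks *)

(** Inside the window the displaced word has exactly [K + c] 0's, those of the first [K + c] rows,
    with empty rows included. *)
Lemma zeros_perm s c K : is_part s -> (extent s + absz c <= K)%N ->
  perm_eq [seq zpos s r + c | r <- iota 0 (absz (K%:Z + c))]
          [seq x <- zr K | ~~ bword s (x - c)].
Proof.
move=> ps le_K; apply: uniq_perm.
- rewrite map_inj_uniq ?iota_uniq // => i j /addIr E.
  by case: (ltngtP i j) => // /(zpos_lt ps); rewrite E ltxx.
- exact/filter_uniq/uniq_zr.
move=> x; rewrite mem_filter mem_zr; apply/mapP/andP => [[r]|[/(bwordP _ ps)[r Er] le_x]].
  rewrite mem_iota => lt_r ->; rewrite addrK bword_zpos //; split=> //.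
  have := part_nth_le ps (leq0n r); rewrite nth0 /zpos.
  by move: le_K; rewrite /extent; lia.
exists r; last by rewrite Er subrK.
rewrite mem_iota; move: Er; rewrite /zpos; have [lt_r|ge_r] := ltnP r (size s).
  by move: le_K; rewrite /extent; lia.
by rewrite nth_default //; lia.
Qed.

Lemma extent_conj s : is_part s -> extent (conj_part s) = extent s.
Proof.
move=> ps; rewrite /extent size_conj addnC; congr addn.
rewrite -nth0 nth_conj_part //; case/andP: ps => _ s0.
apply/eqP; rewrite -all_count; apply/allP => x xs.
by rewrite lt0n; apply: contraNneq s0 => <-.
Qed.

Lemma ones_perm s c K : is_part s -> (extent s + absz c <= K)%N ->
  perm_eq [seq j%:Z - (nth 0%N (conj_part s) j)%:Z + c | j <- iota 0 (absz (K%:Z - c))]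
          [seq x <- zr K | bword s (x - c)].
Proof.
move=> ps le_K; have pc := is_part_conj ps.
have := @zeros_perm (conj_part s) (- c) K pc; rewrite extent_conj // abszN => /(_ le_K).
move/(perm_map (fun x => -1 - x)) => h.
have E : [seq j%:Z - (nth 0%N (conj_part s) j)%:Z + c | j <- iota 0 (absz (K%:Z - c))]
    = [seq -1 - x | x <- [seq zpos (conj_part s) r - c | r <- iota 0 (absz (K%:Z - c))]].
  by rewrite -map_comp; apply: eq_map => r /=; rewrite /zpos; lia.
rewrite E; apply: (perm_trans h); apply: uniq_perm.
- by rewrite map_inj_uniq ?filter_uniq ?uniq_zr // => x y; lia.
- exact/filter_uniq/uniq_zr.
have invK (x : int) : -1 - (-1 - x) = x by lia.
move=> x; rewrite -[x in LHS]invK (mem_map (f := fun y : int => -1 - y)); last by move=> y z; lia.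
rewrite !mem_filter !mem_zr bword_conj // negbK.
by congr (bword _ _ && _); lia.
Qed.

(* The sum of g over the 0's at nonnegative positions minus the sum over the 1's
   at negative positions: the word is compared with that of the empty partition,
   which makes the sum independent of a large enough window. *)
Definition wsum (K : nat) (a : int -> bool) (g : int -> rat) : rat :=
  \sum_(x <- zr K) ((~~ a x)%:R - (x < 0)%R%:R) * g x.

Lemma wsumE K a g :
  wsum K a g = \sum_(x <- zr K | ~~ a x) g x - \sum_(x <- zr K | x < 0) g x.
Proof.
rewrite /wsum (big_mkcond (fun x => ~~ a x)) (big_mkcond (fun x => x < 0)) -sumrB.
by apply: eq_bigr => x _; case: (a x); case: (x < 0) => /=; ring.
Qed.

Lemma wsum_stable K K' a g : vac_outside a K -> (K <= K')%N -> wsum K' a g = wsum K a g.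
Proof.
move=> va le_K; rewrite /wsum (bigID (mem (zr K))) /= [X in _ + X]big1_seq ?addr0.
  rewrite -big_filter; apply: perm_big; apply: uniq_perm; rewrite ?filter_uniq ?uniq_zr //.
  by move=> x; rewrite mem_filter !mem_zr; lia.
move=> x /andP[nx _]; have {nx}: x \notin zr K by []. rewrite mem_zr => nx.
have [h1 h2] := va x; case: (ltrP x 0) => ?.
  by rewrite h1 ?subrr ?mul0r //; lia.
by rewrite h2 ?subrr ?mul0r //; lia.
Qed.

Lemma wsum_eq K a a' g g' : a =1 a' -> g =1 g' -> wsum K a g = wsum K a' g'.
Proof. by move=> Ea Eg; apply: eq_bigr => x _; rewrite Ea Eg. Qed.

Lemma wsumZ K a c g : wsum K a (fun x => c * g x) = c * wsum K a g.
Proof. by rewrite /wsum mulr_sumr; apply: eq_bigr => x _; rewrite mulrCA. Qed.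

Lemma wsum_sum K a I (r : seq I) (P : pred I) (g : I -> int -> rat) :
  wsum K a (fun x => \sum_(i <- r | P i) g i x) = \sum_(i <- r | P i) wsum K a (g i).
Proof.
rewrite /wsum exchange_big /=; apply: eq_bigr => x _; exact: mulr_sumr.
Qed.

Lemma sum_zeros s c K (g : int -> rat) : is_part s -> (extent s + absz c <= K)%N ->
  \sum_(x <- zr K | ~~ bword s (x - c)) g x
    = \sum_(r <- iota 0 (absz (K%:Z + c))) g (zpos s r + c).
Proof.
move=> ps le_K; rewrite -big_filter -(perm_big _ (zeros_perm ps le_K)).
by rewrite big_map.
Qed.

Lemma sum_vac_zeros K (g : int -> rat) :
  \sum_(x <- zr K | x < 0) g x = \sum_(r <- iota 0 K) g (- r.+1%:Z).
Proof.
have := @sum_zeros [::] 0 K g isT; rewrite /extent !add0n addr0 => /(_ isT) E.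
rewrite (eq_bigl (fun x => ~~ bword [::] (x - 0))) => [|x]; last first.
  by rewrite bword_nil subr0 -ltNge.
by rewrite E; apply: eq_bigr => r _; rewrite /zpos nth_nil; congr g; lia.
Qed.

Lemma wsum_rows s K g : is_part s -> (extent s <= K)%N ->
  wsum K (bword s) g = \sum_(r <- iota 0 K) (g (zpos s r) - g (- r.+1%:Z)).
Proof.
move=> ps le_K; rewrite wsumE sum_vac_zeros sumrB; congr (_ - _).
have := @sum_zeros s 0 K g ps; rewrite addn0 addr0 absz_nat => /(_ le_K) E.
rewrite (eq_bigl (fun x => ~~ bword s (x - 0))) => [|x]; last by rewrite subr0.
by rewrite E; apply: eq_bigr => r _; rewrite addr0.
Qed.

Section BoxSums.

Variables (R : Type) (idx : R) (op : Monoid.com_law idx).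

Lemma big_boxes s (F : nat -> nat -> R) A B : is_part s ->
    (size s <= A)%N -> (head 0 s <= B)%N ->
  \big[op/idx]_(b <- boxes s) F b.1 b.2 =
  \big[op/idx]_(i <- iota 0 A) \big[op/idx]_(j <- iota 0 B | (j < nth 0 s i)%N) F i j.
Proof.
move=> ps le_A le_B; rewrite /boxes big_allpairs_dep /=.
rewrite -(subnKC le_A) iotaD big_cat /= [X in op _ X]big1_seq ?Monoid.mulm1.
  apply: eq_big_seq => i; rewrite mem_iota => /andP[_ lt_i].
  have le_i : (nth 0%N s i <= B)%N.
    by apply: leq_trans le_B; rewrite -nth0 part_nth_le.
  rewrite -(subnKC le_i) iotaD big_cat /= [X in op _ X]big1_seq ?Monoid.mulm1.
    by rewrite big_seq_cond [RHS]big_seq_cond; apply: eq_bigl => j; rewrite mem_iota; lia.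
  by move=> j; rewrite mem_iota; lia.
move=> i; rewrite mem_iota => lt_i; apply: big1 => j.
by rewrite nth_default //; lia.
Qed.

(** The box in row i and column j joins the 0 of that row to the 1 of that column, and its hook
    length is their distance. The operation is arbitrary because hooks are multiplied in
    [hook_product] and summed in [hook_sum]; the shift [c] is there for the displaced words of
    quotients. *)
Lemma big_hooks s c K (phi : nat -> R) : is_part s -> (extent s + absz c <= K)%N ->
  \big[op/idx]_(b <- boxes s) phi (hook s b) =
  \big[op/idx]_(y <- zr K | ~~ bword s (y - c))
     \big[op/idx]_(x <- zr K | bword s (x - c) && (x < y)) phi (absz (y - x)).
Proof.
move=> ps le_K; have := le_K; rewrite /extent => le_K'.
rewrite (eq_bigr (fun b => phi (hook s (b.1, b.2)))) => [|[] //].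
rewrite (big_boxes (fun i j => phi (hook s (i, j)))
  (A := absz (K%:Z + c)) (B := absz (K%:Z - c))) //; try lia.
rewrite -[RHS]big_filter -(perm_big _ (zeros_perm ps le_K)) big_map.
apply: eq_bigr => i _; rewrite -[RHS]big_filter.
set p := filter _ (zr K).
have -> : p = [seq x <- [seq x <- zr K | bword s (x - c)] | x < zpos s i + c].
  by rewrite /p -filter_predI; apply: eq_filter => x /=; rewrite andbC.
rewrite big_filter -(perm_big _ (ones_perm ps le_K)) big_map /=.
apply: eq_big => j; first by rewrite -conj_nthP // /zpos; have := conj_nthP i j ps; lia.
by move=> lt_j; have := lt_j; rewrite -conj_nthP // /hook /zpos /= => ?; congr phi; lia.
Qed.

End BoxSums.

(** Along row i the contents fill the interval from -i to [zpos s i], so the differences of [Psi]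
    telescope to its values at [zpos s i] and at -(i + 1). *)
Lemma content_sumE s K (f Psi : int -> rat) : is_part s -> (extent s <= K)%N ->
  (forall x, Psi x - Psi (x - 1) = f x) ->
  \sum_(b <- boxes s) f (content b) = wsum K (bword s) Psi.
Proof.
move=> ps le_K EPsi; rewrite wsum_rows //; have := le_K; rewrite /extent => le_K'.
rewrite (big_boxes _ (fun i j => f (content (i, j))) (A := K) (B := K)) //; try lia.
apply: eq_big_seq => i _; rewrite /zpos.
have le_i : (nth 0%N s i <= K)%N.
  by have := part_nth_le ps (leq0n i); rewrite nth0; lia.
rewrite -big_filter; set l := filter _ _.
have -> : l = iota 0 (nth 0%N s i).
  rewrite /l -(subnKC le_i) iotaD filter_cat (all_filterP _) ?subnKC //.
    rewrite (eq_in_filter (a2 := pred0)) ?filter_pred0 ?cats0 // => j.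
    by rewrite mem_iota /=; lia.
  by apply/allP => j; rewrite mem_iota; lia.
elim: (nth _ _ _) => [|n IH]; first by rewrite big_nil sub0r subrr.
rewrite -addn1 iotaD big_cat big_seq1 /= IH add0n /content /= -EPsi.
rewrite (_ : (n + 1)%N%:Z - i.+1%:Z = n%:Z - i%:Z); last lia.
by rewrite (_ : n%:Z - i%:Z - 1 = n%:Z - i.+1%:Z); [ring | lia].
Qed.

(** * Adding boxes and strips *)

Lemma sub_partP s' s : reflect (forall i, nth 0 s' i <= nth 0 s i)%N (sub_part s' s).
Proof.
apply: (iffP allP) => [h i|h i _]; last exact: h.
have [lt_i|ge_i] := ltnP i (size s'); last by rewrite nth_default.
by apply: h; rewrite mem_iota.
Qed.

Lemma sumn_rows s K : (size s <= K)%N -> sumn s = (\sum_(r <- iota 0 K) nth 0 s r)%N.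
Proof.
move=> le_K; rewrite sumnE -(subnKC le_K) iotaD big_cat /= [X in (_ + X)%N]big1_seq ?addn0.
  by rewrite (big_nth 0%N) /index_iota subn0.
by move=> r; rewrite mem_iota => /andP[_ ?]; rewrite nth_default //; lia.
Qed.

Lemma sub_part_sumn s' s : sub_part s' s -> (sumn s' <= sumn s)%N.
Proof.
move/sub_partP=> sub; rewrite !(sumn_rows (K := size s + size s')) ?leq_addr ?leq_addl //.
by apply: leq_sum => r _; exact: sub.
Qed.

Lemma sub_part_sumn_eq s' s : is_part s' -> is_part s -> sub_part s' s ->
  sumn s = sumn s' -> s = s'.
Proof.
move=> ps' ps /sub_partP sub.
set K := (size s + size s')%N.
rewrite !(sumn_rows (K := K)) ?leq_addr ?leq_addl // => E.
apply: part_ext => // i; have [lt_i|ge_i] := ltnP i K; last first.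
  by rewrite !nth_default //; rewrite /K in ge_i; lia.
have il : i \in iota 0 K by rewrite mem_iota.
have : (\sum_(r <- iota 0 K | r != i) nth 0 s' r <= \sum_(r <- iota 0 K | r != i) nth 0 s r)%N.
  by apply: leq_sum => r _; exact: sub.
by move: E; rewrite !(bigD1_seq i il (iota_uniq _ _)) /=; have := sub i; lia.
Qed.

Lemma sub_part_sumnS s' s : is_part s' -> is_part s -> sub_part s' s ->
  sumn s = (sumn s').+1 ->
  exists r, nth 0%N s r = (nth 0%N s' r).+1 /\
    forall q : nat, q != r -> nth 0%N s q = nth 0%N s' q.
Proof.
move=> ps' ps /sub_partP sub E.
set K := (size s + size s')%N.
have [/hasP ex|/hasPn nlt] := boolP (has (fun r => nth 0 s' r < nth 0 s r)%N (iota 0 K)).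
  have [r rK lt_r] : exists2 r : nat, r \in iota 0 K & (nth 0 s' r < nth 0 s r)%N := ex.
  exists r; move: E; rewrite !(sumn_rows (K := K)) ?leq_addr ?leq_addl //.
  rewrite !(bigD1_seq r rK (iota_uniq _ _)) /=.
  have le_ : (\sum_(q <- iota 0 K | q != r) nth 0 s' q <=
      \sum_(q <- iota 0 K | q != r) nth 0 s q)%N.
    by apply: leq_sum => q _; exact: sub.
  move=> E; split=> [|q neq_q]; first lia.
  have [qK|qK] := boolP (q \in iota 0 K); last first.
    by rewrite !nth_default //; move: qK; rewrite mem_iota /K; lia.
  move: E; rewrite -!(big_filter _ (fun q => q != r)).
  have qf : q \in [seq q <- iota 0 K | q != r] by rewrite mem_filter neq_q.
  have uf : uniq [seq q <- iota 0 K | q != r] by rewrite filter_uniq ?iota_uniq.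
  rewrite !(bigD1_seq q qf uf) /=.
  have : (\sum_(i <- [seq q <- iota 0 K | q != r] | i != q) nth 0 s' i
      <= \sum_(i <- [seq q <- iota 0 K | q != r] | i != q) nth 0 s i)%N.
    by apply: leq_sum => i _; exact: sub.
  have arith (a b c d e f : nat) : (a < b -> c <= d -> e <= f ->
    b + (d + f) = (a + (c + e)).+1 -> d = c)%N by lia.
  exact: arith lt_r (sub q).
suff : sumn s = sumn s' by move=> ?; exfalso; lia.
rewrite !(sumn_rows (K := K)) ?leq_addr ?leq_addl //.
by apply: eq_big_seq => r /nlt; have := sub r; lia.
Qed.

Definition moved (a a' : int -> bool) (k : int) :=
  [/\ a k = false, a (k + 1) & forall x, a' x = (x == k) || (x != k + 1) && a x].

Lemma row_moved s s' r : is_part s -> is_part s' ->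
  nth 0%N s' r = (nth 0%N s r).+1 ->
  (forall q : nat, q != r -> nth 0%N s' q = nth 0%N s q) ->
  moved (bword s) (bword s') (zpos s r).
Proof.
move=> ps ps' Er Eq.
have zr' : zpos s' r = zpos s r + 1 by rewrite /zpos Er; lia.
have zq q : q != r -> zpos s' q = zpos s q by move=> nq; rewrite /zpos Eq.
have inj u q q' : is_part u -> zpos u q = zpos u q' -> q = q'.
  move=> pu E; case: (ltngtP q q') => // /(zpos_lt pu); by rewrite E ltxx.
have one : bword s (zpos s r + 1).
  apply/negPn/negP => /(bwordP _ ps)[q Eqr].
  have nq : q != r by apply: contra_eq_neq Eqr => ->; lia.
  by move: (inj s' q r ps'); rewrite zq // zr' Eqr => /(_ erefl) E; rewrite E eqxx in nq.
split=> //; first exact: bword_zpos.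
move=> x; apply/negb_inj; rewrite negb_or negb_and negbK.
apply/(bwordP _ ps')/andP => [[q <-]|[nx /orP[/eqP->|/(bwordP _ ps)[q Ex]]]].
- have [->|nq] := eqVneq q r; first by rewrite zr' eqxx; split=> //; lia.
  rewrite zq // bword_zpos // orbT; split=> //.
  by apply: contraNneq nq => /(inj s _ _ ps) ->.
- by exists r.
- exists q; rewrite zq //; apply: contraNneq nx => Eqr; by rewrite -Ex Eqr.
Qed.

(** A 1 right after the 0 of row [r] means that the preceding row is strictly longer, so row [r] can
    grow by a box; [r] may be the first empty row. *)
Lemma add_box s k : is_part s -> bword s k = false -> bword s (k + 1) ->
  exists s', [/\ is_part s', sub_part s s', sumn s' = (sumn s).+1 &
    moved (bword s) (bword s') k].
Proof.
move=> ps /negbT/(bwordP _ ps)[r Ek] bk1.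
have le_r : (r <= size s)%N.
  rewrite leqNgt; apply: contraL bk1 => lt_r; apply/(bwordP _ ps); exists r.-1.
  rewrite -Ek /zpos !nth_default //; lia.
have ltr q : (q < r)%N -> (nth 0 s r < nth 0 s q)%N.
  move=> lt_q; rewrite ltnNge; apply: contraL bk1 => le_; apply/(bwordP _ ps); exists r.-1.
  rewrite -Ek /zpos.
  have := part_nth_le ps (i := q) (j := r.-1); have := part_nth_le ps (i := r.-1) (j := r); lia.
pose s' := set_nth 0%N s r (nth 0%N s r).+1.
have nth' q : nth 0%N s' q = if q == r then (nth 0%N s r).+1 else nth 0%N s q.
  by rewrite nth_set_nth.
have ps' : is_part s'.
  apply/andP; split.
    apply/(sortedP 0%N) => i _; rewrite /geq /= !nth'.
    have := part_nth_le ps (leqnSn i); have := @ltr i.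
    by case: eqP => [->|]; case: eqP => [->|] //; lia.
  apply/negP=> /(nthP 0%N)[i]; rewrite size_set_nth nth' => lt_i.
  case: eqP => // ne_i Ei; have := part_nth_gt0 i ps; rewrite Ei ltnn => /esym/negbT.
  rewrite -leqNgt => le_i; case: ne_i; apply/eqP; rewrite eqn_leq (leq_trans le_r le_i) andbT.
  by move: lt_i; rewrite leq_max ltnS => /orP[//|]; rewrite ltnNge le_i.
have sub : sub_part s s' by apply/sub_partP => i; rewrite nth'; case: eqP => [->|].
exists s'; split=> //.
  rewrite (sumn_rows (K := (size s').+1)) // (sumn_rows (s := s) (K := (size s').+1)); last first.
    by rewrite size_set_nth; lia.
  have rK : r \in iota 0 (size s').+1 by rewrite mem_iota size_set_nth; lia.
  rewrite !(bigD1_seq r rK (iota_uniq _ _)) /= nth' eqxx addSn; congr (_ + _).+1.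
  by apply: eq_bigr => q /negPf nq; rewrite nth' nq.
rewrite -Ek; apply: row_moved => //; first by rewrite nth' eqxx.
by move=> q /negPf nq; rewrite nth' nq.
Qed.

Lemma wsum_moved K a a' k g : moved a a' k -> k \in zr K -> k + 1 \in zr K ->
  wsum K a' g - wsum K a g = g (k + 1) - g k.
Proof.
case=> ak ak1 E kK k1K; rewrite /wsum -sumrB.
rewrite (bigD1_seq k kK (uniq_zr K)) -big_filter /=.
have k1f : k + 1 \in [seq i <- zr K | i != k] by rewrite mem_filter k1K andbT; lia.
rewrite (bigD1_seq (k + 1) k1f) ?filter_uniq ?uniq_zr //= big1_seq; last first.
  move=> x /andP[nx1]; rewrite mem_filter => /andP[nx _].
  by rewrite E nx1 (negPf nx) /= subrr.
rewrite !E !eqxx ak ak1 /= (_ : k + 1 == k = false) /=; last lia.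
ring.
Qed.

Lemma zr_classes t K : (0 < t)%N ->
  perm_eq (zr (t * K)) [seq t%:Z * k + i%:Z | i <- iota 0 t, k <- zr K].
Proof.
move=> t0; apply: uniq_perm; first exact: uniq_zr.
  apply: allpairs_uniq; rewrite ?iota_uniq ?uniq_zr //.
  move=> [i k] [i' k'] /allpairsP[[i1 k1] /= [i1P _ [-> ->]]]
    /allpairsP[[i2 k2] /= [i2P _ [-> ->]]] /= E.
  move: i1P i2P; rewrite !mem_iota => lt1 lt2.
  by have : k1 = k2; [nia | move=> Ek; congr (_, _) => //; move: E; rewrite Ek; lia].
move=> x; rewrite mem_zr; apply/idP/allpairsP => [lt_x|[[i k] /= [iP kP ->]]].
  exists (absz (x %% t%:Z)%Z, (x %/ t%:Z)%Z) => /=; rewrite mem_iota mem_zr.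
  have := divz_eq x t%:Z; have := ltz_pmod x (d := t%:Z); have := modz_ge0 x (d := t%:Z).
  by split; nia.
by move: iP kP; rewrite mem_iota mem_zr; nia.
Qed.

(** The window from -tK to tK is exactly the union of the class windows from -K to K. As i < t, the
    position t k + i is negative exactly when k is, so the empty partition splits along with the
    word. *)
Lemma wsum_classes t K a g : (0 < t)%N ->
  wsum (t * K) a g = \sum_(i <- iota 0 t)
     wsum K (fun k => a (t%:Z * k + i%:Z)) (fun k => g (t%:Z * k + i%:Z)).
Proof.
move=> t0; rewrite /wsum (perm_big _ (zr_classes K t0)) big_allpairs_dep /=.
apply: eq_big_seq => i; rewrite mem_iota => lt_i.
apply: eq_bigr => k _; congr ((_ - (nat_of_bool _)%:R) * _); nia.
Qed.

Lemma sumn_conj s : is_part s -> sumn (conj_part s) = sumn s.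
Proof.
move=> ps.
rewrite (sumn_rows (s := conj_part s) (K := head 0%N s)) ?size_conj //.
rewrite (sumn_rows (s := s) (K := size s)) //.
have row u i K : (nth 0 u i <= K)%N -> nth 0%N u i = (\sum_(j <- iota 0 K | (j < nth 0 u i)%N) 1)%N.
  by move=> le_K; rewrite sum1_count -size_filter (filter_iota_ltn 0 le_K) size_iota.
have le_row i : (nth 0 s i <= head 0 s)%N by rewrite -nth0 part_nth_le.
rewrite [RHS](eq_bigr _ (fun i _ => row s i _ (le_row i))).
have le_col j : (nth 0 (conj_part s) j <= size s)%N.
  by rewrite nth_conj_part // count_size.
rewrite (eq_bigr _ (fun j _ => row _ j _ (le_col j))).
rewrite (exchange_big_dep predT) //=; apply: eq_bigr => i _.
by apply: eq_bigl => j; rewrite conj_nthP.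
Qed.

Lemma wsum_quotient s c K (t i : nat) : is_part s -> (extent s + absz c <= K)%N ->
  wsum K (fun x => bword s (x - c)) (fun x => (t%:Z * x + i%:Z)%:~R)
  = t%:R * (sumn s)%:R +
    wsum K (fun x => bword [::] (x - c)) (fun x => (t%:Z * x + i%:Z)%:~R).
Proof.
move=> ps le_K; have := le_K; rewrite /extent => le_K'.
rewrite !wsumE !sum_zeros //; last by rewrite /extent /=; lia.
rewrite (sumn_rows (K := absz (K%:Z + c))) ?natr_sum; last lia.
rewrite mulr_sumr addrA -big_split /=; congr (_ - _); apply: eq_bigr => r _.
rewrite /zpos nth_nil -natrM -[_%:R]/((_ : nat)%:Z%:~R) -intrD; congr (_%:~R).
rewrite PoszM; ring.
Qed.

Lemma sumn_bword s K : is_part s -> (extent s <= K)%N ->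
  wsum K (bword s) (fun x => x%:~R) = (sumn s)%:R.
Proof.
move=> ps le_K; rewrite wsum_rows // (sumn_rows (K := K)) ?natr_sum.
  by apply: eq_bigr => r _; rewrite /zpos -intrB -[_%:R]/((_ : nat)%:Z%:~R); congr (_%:~R); lia.
by move: le_K; rewrite /extent; lia.
Qed.

(** The size is the signed sum of the positions ([sumn_bword]). A class contributes t times the size
    of its quotient plus a term depending on the charge alone, and the latter cancels in the
    difference. *)
Lemma sumn_quotients_diff t s s' : is_part s -> is_part s' -> (0 < t)%N ->
    (forall i, (i < t)%N -> charge t s' i = charge t s i) ->
  (sumn s')%:R - (sumn s)%:R =
  t%:R * \sum_(i <- iota 0 t) ((sumn (quotient t s' i))%:R - (sumn (quotient t s i))%:R) :> rat.
Proof.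
move=> ps ps' t0 Ec.
pose b i := (extent (quotient t s i) + extent (quotient t s' i) + absz (charge t s i))%N.
pose K := (extent s + extent s' + \sum_(i <- iota 0 t) b i)%N.
have le_b i : (i < t)%N -> (b i <= K)%N.
  move=> lt_i; have iP : i \in iota 0 t by rewrite mem_iota.
  by rewrite /K (bigD1_seq i iP (iota_uniq _ _)) /=; lia.
have le_sK : (extent s + extent s' <= t * K)%N.
  by rewrite /K; nia.
rewrite -(@sumn_bword s (t * K)) //; last lia.
rewrite -(@sumn_bword s' (t * K)) //; last lia.
rewrite !wsum_classes // -sumrB mulr_sumr; apply: eq_big_seq => i.
rewrite mem_iota add0n => /andP[_ lt_i].
have [pq Eq] := quotientP ps lt_i; have [pq' Eq'] := quotientP ps' lt_i.
rewrite (wsum_eq _ Eq (fun=> erefl)) (wsum_eq _ Eq' (fun=> erefl)) Ec //.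
have := le_b i lt_i; rewrite /b => le_bi.
rewrite (wsum_quotient (s := quotient t s i)) //
  ?(wsum_quotient (s := quotient t s' i)) //; try lia.
ring.
Qed.

Lemma sum_mirror t (x : nat -> rat) : ~~ odd t ->
  (forall i, (i < t)%N -> x (t - i.+1)%N = x i) ->
  \sum_(i <- iota 0 t) x i = 2%:R * \sum_(i <- iota 0 t./2) x i.
Proof.
move=> et E; have Et : t = (t./2 + t./2)%N by rewrite addnn even_halfK.
have E2 : iota 0 t = iota 0 (t./2) ++ iota (t./2) (t./2) by rewrite {1}Et iotaD.
rewrite E2 big_cat /= -[X in X + _]mul1r -[X in _ + X]mul1r (_ : 2%:R = 1 + 1) // mulrDl.
congr (_ + 1 * _).
have pe : perm_eq (iota (t./2) (t./2)) [seq (t - i.+1)%N | i <- iota 0 (t./2)].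
  apply: uniq_perm; rewrite ?iota_uniq //.
    rewrite map_inj_in_uniq ?iota_uniq // => i j; rewrite !mem_iota; lia.
  move=> j; apply/idP/mapP => [|[i]]; rewrite mem_iota; last by move=> ? ->; rewrite mem_iota; lia.
  by move=> h; exists (t - j.+1)%N; rewrite ?mem_iota; lia.
rewrite (perm_big _ pe) big_map; apply: eq_big_seq => i; rewrite mem_iota => lt_i.
by apply: E; lia.
Qed.

(** * The order [ge_t] and its covering steps *)

Lemma ge_tP t s' s : self_conj s' -> self_conj s -> (0 < t)%N ->
  reflect ((forall i, (i < t)%N -> charge t s' i = charge t s i) /\
      forall i, (i < t./2)%N -> sub_part (quotient t s i) (quotient t s' i)) (ge_t t s' s).
Proof.
move=> sc' sc t0; apply: (iffP andP) => [[/eqP/(core_eqP sc' sc t0) Ec /allP sub]|[Ec sub]].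
  by split=> // i lt_i; apply: sub; rewrite mem_iota.
split; first by apply/eqP/(core_eqP sc' sc t0).
by apply/allP => i; rewrite mem_iota => /andP[_ lt_i]; exact: sub.
Qed.

Lemma half_lt t i : (i < t./2)%N -> (i < t)%N.
Proof. by move=> lt_i; lia. Qed.

(** Mirror classes carry conjugate quotients, which have equal size, so the sum over all classes is
    twice the sum over the first half. *)
Lemma charges_sumn t s' s : self_conj s' -> self_conj s -> ~~ odd t -> (0 < t)%N ->
    (forall i, (i < t)%N -> charge t s' i = charge t s i) ->
  (sumn s')%:Z - (sumn s)%:Z =
  (2 * t)%N%:Z * ((\sum_(i <- iota 0 t./2) sumn (quotient t s' i))%N%:Z
     - (\sum_(i <- iota 0 t./2) sumn (quotient t s i))%N%:Z).
Proof.
move=> sc' sc et t0 Ec.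
have ps := self_conj_part sc; have ps' := self_conj_part sc'.
have := sumn_quotients_diff ps ps' t0 Ec.
rewrite sum_mirror // => [E|i lt_i]; last first.
  have [-> _] := self_conj_quotient sc lt_i; have [-> _] := self_conj_quotient sc' lt_i.
  by rewrite !sumn_conj //; [have [] := quotientP ps lt_i | have [] := quotientP ps' lt_i].
apply: (@intr_inj rat); rewrite intrM !intrB -!pmulrn natrM.
by rewrite E sumrB !natr_sum; ring.
Qed.

Lemma subword_ext t s s' : is_part s -> is_part s' -> (0 < t)%N ->
  (forall i, (i < t)%N -> subword t s i =1 subword t s' i) -> s = s'.
Proof.
move=> ps ps' t0 E; apply: bword_inj => // x.
have := divz_eq x t%:Z; have := ltz_pmod x (d := t%:Z); have := modz_ge0 x (d := t%:Z).
move=> h1 h2 Ex; have lt_i : (absz (x %% t%:Z)%Z < t)%N by lia.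
have := E _ lt_i (x %/ t%:Z)%Z; rewrite /subword.
by rewrite (_ : _ + _ = x) //; lia.
Qed.

Lemma quotients_ext t s s' : self_conj s -> self_conj s' -> ~~ odd t -> (0 < t)%N ->
  (forall i, (i < t)%N -> charge t s' i = charge t s i) ->
  (forall i, (i < t./2)%N -> quotient t s' i = quotient t s i) ->
  forall i, (i < t)%N -> quotient t s' i = quotient t s i.
Proof.
move=> sc sc' et t0 Ec Eq i lt_i; have [/Eq //|ge_i] := ltnP i t./2.
have lt_m : (t - i.+1 < t)%N by lia.
have := self_conj_quotient sc lt_m; have := self_conj_quotient sc' lt_m.
rewrite (_ : t - (t - i.+1).+1 = i)%N => [[-> _] [-> _]|]; last lia.
by rewrite Eq //; lia.
Qed.

Lemma ge_t_eq t s' s : self_conj s' -> self_conj s -> ~~ odd t -> (0 < t)%N ->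
  ge_t t s' s -> sumn s' = sumn s -> s' = s.
Proof.
move=> sc' sc et t0 /(ge_tP sc' sc t0)[Ec sub] Esz.
have ps := self_conj_part sc; have ps' := self_conj_part sc'.
have := charges_sumn sc' sc et t0 Ec; rewrite Esz subrr => E.
have {}E : (\sum_(i <- iota 0 t./2) sumn (quotient t s' i) =
    \sum_(i <- iota 0 t./2) sumn (quotient t s i))%N.
  by nia.
have Eq i : (i < t./2)%N -> quotient t s' i = quotient t s i.
  move=> lt_i; have lt_t := half_lt lt_i.
  have [pq _] := quotientP ps lt_t; have [pq' _] := quotientP ps' lt_t.
  apply: sub_part_sumn_eq => //; first exact: sub.
  have iP : i \in iota 0 t./2 by rewrite mem_iota.
  move: E; rewrite !(bigD1_seq i iP (iota_uniq _ _)) /=.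
  have : (\sum_(j <- iota 0 t./2 | j != i) sumn (quotient t s j) <=
    \sum_(j <- iota 0 t./2 | j != i) sumn (quotient t s' j))%N.
    rewrite big_seq_cond [leqRHS]big_seq_cond; apply: leq_sum => j.
    by rewrite mem_iota => /andP[/andP[_ lt_j] _]; exact/sub_part_sumn/sub.
  have := sub_part_sumn (sub i lt_i).
  set A := (\sum_(_ <- _ | _) _)%N; set B := (\sum_(_ <- _ | _) _)%N; lia.
apply: (@subword_ext t) => // i lt_i k.
have [_ ->] := quotientP ps lt_i; have [_ ->] := quotientP ps' lt_i.
by rewrite Ec // (quotients_ext sc sc').
Qed.

(* One 2t-step of the growth: a 0 of class i moves from k to k + 1, and by
   self-conjugacy a 0 of class t - 1 - i moves from -2 - k to -1 - k. *)
Record step (t : nat) (s r : seq nat) (i : nat) (k : int) : Prop := Step {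
  step_sc : self_conj r;
  step_moved : moved (subword t s i) (subword t r i) k;
  step_mirror : moved (subword t s (t - i.+1)) (subword t r (t - i.+1)) (- 2%:Z - k);
  step_other : forall j, (j < t)%N -> j != i -> j != (t - i.+1)%N ->
    subword t r j =1 subword t s j;
  step_charge : forall j, (j < t)%N -> charge t r j = charge t s j;
  step_quotient : forall j, (j < t./2)%N -> j != i -> quotient t r j = quotient t s j;
  step_sub : sub_part (quotient t s i) (quotient t r i);
  step_sumn : sumn (quotient t r i) = (sumn (quotient t s i)).+1 }.

Lemma moved_mirror a a' b b' k : moved a a' k ->
  (forall x, b x = ~~ a (-1 - x)) -> (forall x, b' x = ~~ a' (-1 - x)) ->
  moved b b' (- 2%:Z - k).
Proof.
case=> ak ak1 Ea Eb Eb'; split.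
- by rewrite Eb (_ : -1 - _ = k + 1) ?ak1 //; lia.
- by rewrite Eb (_ : -1 - _ = k) ?ak //; lia.
move=> x; rewrite Eb' Ea negb_or negb_and Eb.
rewrite (_ : (-1 - x == k) = (x == - 2%:Z - k + 1)); last lia.
rewrite (_ : (-1 - x != k + 1) = (x != - 2%:Z - k)); last lia.
by rewrite negbK; have [->|] := eqVneq x (- 2%:Z - k); rewrite //=; lia.
Qed.

Lemma moved_shift a a' b b' k c : moved a a' (k - c) ->
  (forall x, b x = a (x - c)) -> (forall x, b' x = a' (x - c)) -> moved b b' k.
Proof.
case=> ak ak1 Ea Eb Eb'; split; rewrite ?Eb //.
  by rewrite addrAC.
move=> x; rewrite Eb' Ea Eb; congr (_ || ~~ _ && _); lia.
Qed.

Lemma moved_inj a a' k k' : moved a a' k -> moved a a' k' -> k = k'.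
Proof.
move=> [ak _ E] [ak' _ E']; have := E k; rewrite eqxx /= E' ak andbF orbF.
by move/eqP.
Qed.

(** By the size formula the first t/2 quotients gain one box in total. Hence one of them gains a
    box, and the others, included in the new ones and of the same size, do not change. *)
Lemma grow_step t s r : self_conj s -> self_conj r -> ~~ odd t -> (0 < t)%N ->
  ge_t t r s -> sumn r = (sumn s + 2 * t)%N ->
  exists i k, (i < t./2)%N /\ step t s r i k.
Proof.
move=> sc sc' et t0 /(ge_tP sc' sc t0)[Ec sub] Esz.
have ps := self_conj_part sc; have ps' := self_conj_part sc'.
have := charges_sumn sc' sc et t0 Ec; rewrite Esz => E.
have {}E : (\sum_(i <- iota 0 t./2) sumn (quotient t r i) =
    (\sum_(i <- iota 0 t./2) sumn (quotient t s i)).+1)%N.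
  by nia.
have [i lt_i lt_sz] : exists2 i, (i < t./2)%N & (sumn (quotient t s i) < sumn (quotient t r i))%N.
  have /hasP[i] : has (fun i => sumn (quotient t s i) < sumn (quotient t r i))%N (iota 0 t./2).
    apply: contraPT E => /hasPn h; apply/eqP; rewrite neq_ltn ltnS; apply/orP; left.
    rewrite big_seq [leqRHS]big_seq; apply: leq_sum => i /h; rewrite -leqNgt //.
  by rewrite mem_iota => lt_i ?; exists i.
have iP : i \in iota 0 t./2 by rewrite mem_iota.
have lei (j : nat) : (j < t./2)%N -> (sumn (quotient t s j) <= sumn (quotient t r j))%N.
  by move=> /sub/sub_part_sumn.
move: E; rewrite !(bigD1_seq i iP (iota_uniq _ _)) /= => E.
have le_rest : (\sum_(j <- iota 0 t./2 | j != i) sumn (quotient t s j) <=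
    \sum_(j <- iota 0 t./2 | j != i) sumn (quotient t r j))%N.
  rewrite big_seq_cond [leqRHS]big_seq_cond; apply: leq_sum => j.
  by rewrite mem_iota => /andP[/andP[_ lt_j] _]; exact: lei.
have [Ei Erest] : sumn (quotient t r i) = (sumn (quotient t s i)).+1 /\
    (\sum_(j <- iota 0 t./2 | j != i) sumn (quotient t s j) =
    \sum_(j <- iota 0 t./2 | j != i) sumn (quotient t r j))%N.
  move: E le_rest; set A := (\sum_(_ <- _ | _) _)%N; set B := (\sum_(_ <- _ | _) _)%N.
  by move=> *; split; lia.
have Eq j : (j < t./2)%N -> j != i -> quotient t r j = quotient t s j.
  move=> lt_j nj; have lt_t := half_lt lt_j.
  have [pq _] := quotientP ps lt_t; have [pq' _] := quotientP ps' lt_t.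
  apply: sub_part_sumn_eq => //; first exact: sub.
  have jP : j \in [seq j <- iota 0 t./2 | j != i] by rewrite mem_filter nj mem_iota.
  move: Erest; rewrite -!(big_filter _ (fun j => j != i)).
  rewrite !(bigD1_seq j jP) ?filter_uniq ?iota_uniq //=.
  have : (\sum_(l <- [seq j <- iota 0 t./2 | j != i] | l != j) sumn (quotient t s l) <=
    \sum_(l <- [seq j <- iota 0 t./2 | j != i] | l != j) sumn (quotient t r l))%N.
    rewrite big_seq_cond [leqRHS]big_seq_cond; apply: leq_sum => l.
    by rewrite mem_filter mem_iota => /andP[/and3P[_ _ lt_l] _]; exact: lei.
  have arith (a b c d : nat) : (a <= b -> c <= d -> c + a = d + b -> d = c)%N by clear; lia.
  by move=> h1 h2; apply: arith h1 (lei j lt_j) h2.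
have lt_it := half_lt lt_i.
have [pq bq] := quotientP ps lt_it; have [pq' bq'] := quotientP ps' lt_it.
have [l [El El']] := sub_part_sumnS pq pq' (sub i lt_i) Ei.
have mv := row_moved pq pq' El El'.
pose k := zpos (quotient t s i) l + charge t s i.
have mvk : moved (subword t s i) (subword t r i) k.
  apply: moved_shift bq _; first by rewrite /k addrK; exact: mv.
  by move=> x; rewrite bq' Ec.
exists i, k; split=> //; split=> //.
- apply: moved_mirror mvk _ _ => x; exact: self_conj_sub_mirror.
- move=> j lt_j nj nj' x.
  have [_ ->] := quotientP ps' lt_j; have [_ ->] := quotientP ps lt_j; rewrite Ec //.
  congr bword; have [/Eq|ge_j] := ltnP j t./2; first exact.
  have lt_m : (t - j.+1 < t)%N by lia.
  have := self_conj_quotient sc lt_m; have := self_conj_quotient sc' lt_m.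
  rewrite (_ : t - (t - j.+1).+1 = j)%N => [[-> _] [-> _]|]; last lia.
  rewrite Eq //; first by clear -ge_j lt_j et; lia.
  by apply: contraNneq nj' => <-; apply/eqP; clear -lt_j; lia.
- exact: sub.
Qed.

Lemma class_position_eq t i j (x k : int) : (i < t)%N -> (j < t)%N ->
  (t%:Z * x + j%:Z == t%:Z * k + i%:Z) = (x == k) && (j == i).
Proof.
move=> lt_i lt_j; apply/eqP/andP => [E|[/eqP-> /eqP->] //].
have Exk : x = k by case: (ltgtP x k) => // lt; nia.
by split; apply/eqP => //; move: E; rewrite Exk; lia.
Qed.

(** The 0 at [t k + i] jumps to [t (k + 1) + i], and the image of this move under x -> -1 - x is
    made at the same time, so that the word stays symmetric. *)
Definition add_word (t : nat) (s : seq nat) (i : nat) (k x : int) : bool :=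
  [|| x == t%:Z * k + i%:Z, x == -1 - (t%:Z * (k + 1) + i%:Z)
    | [&& x != t%:Z * (k + 1) + i%:Z, x != -1 - (t%:Z * k + i%:Z) & bword s x]].

Definition add_strip (t : nat) (s : seq nat) (i : nat) (k : int) : seq nat :=
  decode (window (add_word t s i k) (extent s + 2 * t)).

Lemma add_stripP t s i k : self_conj s -> ~~ odd t -> (i < t./2)%N ->
  subword t s i k = false -> subword t s i (k + 1) ->
  [/\ step t s (add_strip t s i k) i k, ge_t t (add_strip t s i k) s &
     sumn (add_strip t s i k) = (sumn s + 2 * t)%N].
Proof.
move=> sc et lt_i ak ak1; have ps := self_conj_part sc.
have lt_it := half_lt lt_i; have t0 : (0 < t)%N by lia.
have va := bword_vac ps.
have low : - (extent s)%:Z <= t%:Z * (k + 1) + i%:Z.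
  by rewrite leNgt; apply: contraL ak1 => /(va _).1; rewrite /subword => ->.
have high : t%:Z * k + i%:Z < (extent s)%:Z.
  by rewrite ltNge; apply/negP => /(va _).2; rewrite /subword in ak; rewrite ak.
have vw : vac_outside (add_word t s i k) (extent s + 2 * t).
  move=> x; rewrite /add_word; split=> hx;
    [rewrite (va x).1; last lia | rewrite (va x).2; last lia].
    by rewrite !andbF orbF; apply/negbTE; rewrite negb_or; apply/andP; split; nia.
  by rewrite andbT; apply/orP; right; apply/orP; right; apply/andP; split; nia.
have [pr br] := decode_window vw.
have mir x : add_word t s i k (-1 - x) = ~~ add_word t s i k x.
  rewrite /add_word bword_self_conj //.
  have -> : t%:Z * (k + 1) + i%:Z = (t%:Z * k + i%:Z) + t%:Z by ring.
  by move: (t%:Z * k + i%:Z) => y; case: (bword s x); lia.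
have [E0 scr] := symmetric_word pr br mir.
set r := add_strip t s i k.
have {}pr : is_part r := pr; have {}scr : self_conj r := scr.
have {vw}br x : bword r x = add_word t s i k x by rewrite [LHS]br E0 addr0.
clearbody r.
have sub j x : (j < t)%N -> subword t r j x =
    [|| (x == k) && (j == i), (x == - 2%:Z - k) && (j == t - i.+1)%N
     | [&& ~~ ((x == k + 1) && (j == i)), ~~ ((x == -1 - k) && (j == t - i.+1)%N)
      & subword t s j x]].
  move=> lt_j; rewrite /subword br /add_word; congr [|| _, _ | [&& ~~ _, ~~ _ & _]].
  - exact: class_position_eq.
  - rewrite (_ : -1 - _ = t%:Z * (- 2%:Z - k) + (t - i.+1)%N%:Z); last nia.
    by apply: class_position_eq; lia.
  - exact: class_position_eq.
  - rewrite (_ : -1 - _ = t%:Z * (-1 - k) + (t - i.+1)%N%:Z); last nia.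
    by apply: class_position_eq; lia.
have ne_i : (i == t - i.+1)%N = false by apply/eqP; lia.
have mvk : moved (subword t s i) (subword t r i) k.
  split=> // x; rewrite sub // eqxx ne_i !andbT !andbF /=; lia.
have mvm : moved (subword t s (t - i.+1)) (subword t r (t - i.+1)) (- 2%:Z - k).
  apply: moved_mirror mvk _ _ => x; exact: self_conj_sub_mirror.
have oth j : (j < t)%N -> j != i -> j != (t - i.+1)%N -> subword t r j =1 subword t s j.
  by move=> lt_j /negPf nj /negPf nj' x; rewrite sub // nj nj' !andbF.
have [pq bq] := quotientP ps lt_it; have [pq' bq'] := quotientP pr lt_it.
have [||u [pu subu szu mvu]] := @add_box (quotient t s i) (k - charge t s i) pq.
- by rewrite -bq.
- by rewrite addrAC -bq.
have mvu' := moved_shift mvu bq (fun x => erefl (bword u (x - charge t s i))).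
have [Equ Ecu] : quotient t r i = u /\ charge t r i = charge t s i.
  apply: bword_shift_inj => // x; rewrite -bq'.
  by case: mvk => _ _ ->; case: mvu' => _ _ ->.
have Eoth j : (j < t)%N -> j != i -> j != (t - i.+1)%N ->
    quotient t r j = quotient t s j /\ charge t r j = charge t s j.
  move=> lt_j nj nj'; have [pj bj] := quotientP ps lt_j; have [pj' bj'] := quotientP pr lt_j.
  by apply: bword_shift_inj => // x; rewrite -bj' -bj oth.
have Ec j : (j < t)%N -> charge t r j = charge t s j.
  move=> lt_j; have [->//|nj] := eqVneq j i.
  have [->|nj'] := eqVneq j (t - i.+1)%N; last by have [] := Eoth j.
  have [_ ->] := self_conj_quotient sc lt_it.
  by have [_ ->] := self_conj_quotient scr lt_it; rewrite Ecu.
have Eq j : (j < t./2)%N -> j != i -> quotient t r j = quotient t s j.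
  move=> lt_j nj; have nj' : j != (t - i.+1)%N.
    by apply/eqP => Ej; clear -Ej lt_i lt_j; lia.
  by have [] := Eoth j (half_lt lt_j) nj nj'.
have st : step t s r i k.
  by split=> //; rewrite Equ.
have ge : ge_t t r s.
  apply/(ge_tP scr sc t0); split=> // j lt_j.
  by have [->|nj] := eqVneq j i; rewrite ?Equ // Eq //; apply/sub_partP.
have Esum : (\sum_(j <- iota 0 t./2) sumn (quotient t r j) =
    (\sum_(j <- iota 0 t./2) sumn (quotient t s j)).+1)%N.
  have iP : i \in iota 0 t./2 by rewrite mem_iota.
  rewrite (bigD1_seq i iP (iota_uniq _ _)) [in RHS](bigD1_seq i iP (iota_uniq _ _)) /=.
  rewrite Equ szu addSn; congr (_ + _).+1.
  rewrite big_seq_cond [RHS]big_seq_cond; apply: eq_bigr => j.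
  by rewrite mem_iota => /andP[/andP[_ lt_j] nj]; rewrite Eq.
split=> //; have := charges_sumn scr sc et t0 Ec; rewrite Esum.
by move: (\sum_(_ <- _) _)%N => S; rewrite (_ : S.+1%:Z - S%:Z = 1) ?mulr1; clear; lia.
Qed.

(* Otherwise [done] tries to evaluate the decoding. *)
#[global] Opaque add_strip.

Lemma step_unique t s r r' i k : step t s r i k -> step t s r' i k -> (0 < t)%N -> r = r'.
Proof.
move=> S S' t0.
apply: (@subword_ext t _ _ (self_conj_part (step_sc S)) (self_conj_part (step_sc S')) t0).
move=> j lt_j x; have [->|nj] := eqVneq j i.
  by have [_ _ ->] := step_moved S; have [_ _ ->] := step_moved S'.
have [->|nj'] := eqVneq j (t - i.+1)%N.
  by have [_ _ ->] := step_mirror S; have [_ _ ->] := step_mirror S'.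
by rewrite (step_other S) // (step_other S').
Qed.

Lemma step_index t s r i k i' k' : (i < t./2)%N -> (i' < t./2)%N ->
  step t s r i k -> step t s r i' k' -> i = i' /\ k = k'.
Proof.
move=> lt_i lt_i' S S'; have Ei : i = i'.
  apply/eqP/negPn/negP => ni; have [a0 _ /(_ k)] := step_moved S.
  by rewrite (step_other S') ?a0 ?eqxx //; lia.
split=> //; subst i'; exact: moved_inj (step_moved S) (step_moved S').
Qed.

(** The window is enlarged by one because [k] can be - [extent s] - 1, just before the first place
    where a 1 is possible. *)
Definition addable (t : nat) (s : seq nat) (i : nat) : seq int :=
  [seq k <- zr (extent s).+1 | ~~ subword t s i k && subword t s i (k + 1)].

Lemma mem_addable t s i k : is_part s -> (i < t)%N ->
  (k \in addable t s i) = ~~ subword t s i k && subword t s i (k + 1).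
Proof.
move=> ps lt_i; rewrite mem_filter mem_zr.
case Eb: (~~ subword t s i k && subword t s i (k + 1)) => //=; case/andP: Eb => ak ak1.
have va := subword_vac ps lt_i.
have h1 : ~ (k + 1 < - (extent s)%:Z) by move/(va _).1; rewrite ak1.
have h2 : ~ ((extent s)%:Z <= k) by move/(va _).2; apply/negP.
by clear -h1 h2; lia.
Qed.

(** This reindexes the sum in [Dt] by the class and the position of the moving 0. Distinct pairs
    give distinct partitions by [step_index]. *)
Lemma grow_perm t s : self_conj s -> ~~ odd t -> (0 < t)%N ->
  perm_eq [seq r <- partitions_of (sumn s + 2 * t) | self_conj r && ge_t t r s]
    [seq add_strip t s i k | i <- iota 0 t./2, k <- addable t s i].
Proof.
move=> sc et t0; have ps := self_conj_part sc.
have addP i k : i \in iota 0 t./2 -> k \in addable t s i ->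
    (i < t./2)%N /\ [/\ step t s (add_strip t s i k) i k, ge_t t (add_strip t s i k) s &
     sumn (add_strip t s i k) = (sumn s + 2 * t)%N].
  rewrite mem_iota => /andP[_ lt_i]; rewrite (mem_addable _ ps (half_lt lt_i)).
  by case/andP=> /negbTE ak ak1; split; [|exact: add_stripP].
apply: uniq_perm.
- exact/filter_uniq/uniq_partitions_of.
- apply: allpairs_uniq_dep; first exact: iota_uniq.
    by move=> i _; exact/filter_uniq/uniq_zr.
  move=> [i k] [i' k'] /allpairsPdep[i1 [k1 [iP kP [-> ->]]]]
    /allpairsPdep[i2 [k2 [iP' kP' [-> ->]]]] /= E.
  have [lt1 [S1 _ _]] := addP _ _ iP kP; have [lt2 [S2 _ _]] := addP _ _ iP' kP'.
  by rewrite -E in S2; have [-> ->] := step_index lt1 lt2 S1 S2.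
move=> r; rewrite mem_filter mem_partitions_of; apply/idP/allpairsPdep => [|[i [k [iP kP ->]]]].
  case/and3P=> /andP[sc' ge] _ /eqP Esz.
  have [i [k [lt_i S]]] := grow_step sc sc' et t0 ge Esz.
  have [a0 a1 _] := step_moved S; have lt_it := half_lt lt_i.
  exists i, k; rewrite mem_iota mem_addable // a0 a1; split=> //.
  by apply: step_unique S _ t0; have [] := add_stripP sc et lt_i a0 a1.
have [lt_i [S -> ->]] := addP _ _ iP kP.
by rewrite (step_sc S) (self_conj_part (step_sc S)) eqxx.
Qed.

(** * Moments of rational functions *)

Section Moments.

Variable F : fieldType.
Implicit Types (X Y : seq F) (s K : nat -> F).

(* [mom X Y d] is the coefficient of z^(-d-1) in
   prod_(y in Y) (z - y) / prod_(x in X) (z - x), expanded by residues. *)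
Definition mom X Y (d : nat) : F :=
  \sum_(a <- X) (\prod_(y <- Y) (a - y)) / (\prod_(b <- X | b != a) (a - b)) * a ^+ d.

Lemma mom_consY X y Y d : mom X (y :: Y) d = mom X Y d.+1 - y * mom X Y d.
Proof.
rewrite /mom mulr_sumr -sumrB; apply: eq_bigr => a _; rewrite big_cons exprS; ring.
Qed.

Lemma mom_perm X X' Y d : perm_eq X X' -> mom X Y d = mom X' Y d.
Proof.
move=> pX; rewrite /mom (perm_big _ pX); apply: eq_bigr => a _.
by rewrite (perm_big _ pX).
Qed.

(** Multiplication by z - x removes the pole at x: the residue at x itself gets the factor 0, and at
    the other poles a - x cancels from the denominator. *)
Lemma mom_consX x X d : uniq (x :: X) ->
  mom (x :: X) [::] d.+1 = x * mom (x :: X) [::] d + mom X [::] d.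
Proof.
move=> /andP[nx uX]; apply/eqP; rewrite addrC -subr_eq; apply/eqP.
rewrite /mom mulr_sumr -sumrB big_cons big_nil exprS.
rewrite [X in X + _ = _](_ : _ = 0) ?add0r; last by ring.
apply: eq_big_seq => a aX; rewrite !big_nil big_cons exprS.
have nxa : a - x != 0 by rewrite subr_eq0; apply: contraNneq nx => <-.
rewrite eq_sym -subr_eq0 nxa invfM; set P := (\prod_(_ <- _ | _) _)^-1.
by rewrite mul1r; field.
Qed.

(** Euler's identity: the expansion of 1 / prod (z - x) at infinity begins with z to the power -
    [size X]. *)
Lemma mom_low X d : uniq X -> (d < size X)%N -> mom X [::] d = (d == (size X).-1)%:R.
Proof.
elim: d X => [|d IH] X uX.
  move: {2}(size X) (leqnn (size X)) uX => n.
  elim: n X => [|n IHn] [|x [|x' X]] //= le_n uX _.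
    by rewrite /mom big_seq1 big_nil big_cons eqxx /= big_nil expr0 mulr1 divr1.
  have [nxx' ux' ux] : [/\ x != x', uniq (x' :: X) & uniq (x :: X)].
    by move: uX; rewrite /= inE negb_or -!andbA => /and4P[-> -> -> ->].
  have uX' : uniq (x' :: x :: X).
    by move: uX; rewrite /= !inE !negb_or eq_sym => /and3P[/andP[-> ->] -> ->].
  (* Removing x and removing x' give two expressions for the moment of order 1. The moments of the
     two shorter lists agree by induction, so x - x' times the moment of order 0 vanishes. *)
  have E1 := mom_consX 0 uX; have E2 := mom_consX 0 uX'.
  have pe : perm_eq (x' :: x :: X) (x :: x' :: X).
    by rewrite -[x' :: x :: X]/([:: x'] ++ [:: x] ++ X)
      -[x :: x' :: X]/([:: x] ++ [:: x'] ++ X) perm_catCA.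
  rewrite !(mom_perm _ _ pe) in E2.
  have Em : mom (x' :: X) [::] 0 = mom (x :: X) [::] 0 by rewrite !IHn.
  apply/eqP; rewrite -(inj_eq (mulfI (_ : x - x' != 0))) ?subr_eq0 // mulr0.
  apply/eqP; rewrite mulrBl; move: E1; rewrite E2 Em; move/addIr => ->; ring.
case: X uX => // x X uX /= lt_d.
rewrite mom_consX // !IH //=; [|by case/andP: uX|lia].
have -> : (d == size X) = false by lia.
by rewrite mulr0 add0r; congr (_%:R); case: (X) lt_d => //= *; lia.
Qed.

Definition conv K s d := \sum_(m < d) K m.+1 * s (d - m.+1)%N.

(* w S'(w) / S(w) = sum_(m >= 1) K_m w^m for S(w) = sum_d s_d w^d. *)
Definition log_derivative K s := forall d, d%:R * s d = conv K s d.

Lemma convD K K' s d : conv (fun m => K m + K' m) s d = conv K s d + conv K' s d.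
Proof. by rewrite /conv -big_split; apply: eq_bigr => m _; rewrite mulrDl. Qed.

Lemma convN K s d : conv (fun m => - K m) s d = - conv K s d.
Proof. by rewrite /conv -sumrN; apply: eq_bigr => m _; rewrite mulNr. Qed.

Lemma conv_shift K s s' y d : s' 0%N = s 0%N ->
  (forall e, s' e.+1 = s e.+1 - y * s e) ->
  conv K s' d.+1 = conv K s d.+1 - y * conv K s d.
Proof.
move=> E0 E; rewrite /conv !big_ord_recr /= !subSS !subnn E0 mulr_sumr.
rewrite addrAC -sumrB; congr (_ + _); apply: eq_bigr => m _.
by rewrite !subSS -(subnSK (ltn_ord m)) E; ring.
Qed.

Lemma conv_pow y s d : conv (fun m => y ^+ m) s d.+1 = y * s d + y * conv (fun m => y ^+ m) s d.
Proof.
rewrite /conv big_ord_recl /= expr1 subSS subn0; congr (_ + _).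
by rewrite mulr_sumr; apply: eq_bigr => m _; rewrite subSS exprS mulrA.
Qed.

Lemma conv_pow_shift y s s' d : s' 0%N = s 0%N ->
  (forall e, s' e.+1 = s e.+1 - y * s e) -> conv (fun m => y ^+ m) s' d.+1 = y * s d.
Proof.
move=> E0 E; elim: d => [|d IH]; first by rewrite conv_pow /conv big_ord0 E0; ring.
by rewrite conv_pow IH E; ring.
Qed.

(** The new series is (1 - y w) S(w); the factor contributes -y w / (1 - y w), whose coefficients
    are -y^m, to the logarithmic derivative. *)
Lemma log_derivative_mul K s s' y : log_derivative K s -> s' 0%N = s 0%N ->
  (forall e, s' e.+1 = s e.+1 - y * s e) ->
  log_derivative (fun m => K m - y ^+ m) s'.
Proof.
move=> R E0 E [|d]; first by rewrite /conv big_ord0 mul0r.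
rewrite convD convN (conv_pow_shift d E0 E) (conv_shift K d E0 E) -!R E; ring.
Qed.

(** The new series is S(w) / (1 - x w). The convolution with x^m now involves the quotient series
    itself, so an induction on the order is required. *)
Lemma log_derivative_div K s s' x : log_derivative K s -> s' 0%N = s 0%N ->
  (forall e, s' e.+1 = x * s' e + s e.+1) ->
  log_derivative (fun m => K m + x ^+ m) s'.
Proof.
move=> R E0 E d; elim: d => [|d IH]; first by rewrite /conv big_ord0 mul0r.
have Ke : conv K s d.+1 = conv K s' d.+1 - x * conv K s' d.
  apply: conv_shift => // e; rewrite E; ring.
rewrite convD conv_pow E.
have -> : conv K s' d.+1 = d.+1%:R * s d.+1 + x * conv K s' d by rewrite R Ke; ring.
have {IH} -> : conv K s' d = d%:R * s' d - conv (fun m => x ^+ m) s' d.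
  by rewrite IH convD addrK.
by rewrite -natr1; ring.
Qed.

Definition pow_sum X (m : nat) : F := \sum_(x <- X) x ^+ m.

Lemma log_derivative_ext K K' s s' : K =1 K' -> s =1 s' ->
  log_derivative K s -> log_derivative K' s'.
Proof.
by move=> EK Es R d; rewrite -Es R; apply: eq_bigr => m _; rewrite EK Es.
Qed.

Lemma log_derivative_mom_nil X : uniq X -> (0 < size X)%N ->
  log_derivative (pow_sum X) (fun d => mom X [::] (d + (size X).-1)).
Proof.
elim: X => // x [|x' X] IH uX _.
  move=> d; rewrite /conv.
  have E e : mom [:: x] [::] e = x ^+ e.
    by rewrite /mom big_seq1 big_nil big_cons eqxx /= big_nil divr1 mul1r.
  rewrite addn0 E (eq_bigr (fun _ => x ^+ d)) ?sumr_const ?card_ord ?mulr_natl // => m _.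
  by rewrite addn0 E /pow_sum big_seq1 -exprD; congr (_ ^+ _); have := ltn_ord m; lia.
have ux : uniq (x' :: X) by case/andP: uX.
have R : log_derivative (fun m => pow_sum (x' :: X) m + x ^+ m)
    (fun d => mom (x :: x' :: X) [::] (d + (size X).+1)).
  apply: log_derivative_div (IH ux isT) _ _ => [|e] /=.
    by rewrite !add0n !mom_low //= ?ltnSn // !eqxx.
  by rewrite addSn mom_consX // addnS.
apply: log_derivative_ext R => [m|//].
by rewrite /pow_sum [in RHS]big_cons addrC.
Qed.

(** In w = 1/z the rational function is w prod (1 - y w) / prod (1 - x w), so the logarithmic
    derivative of the moment series is a difference of power sums. *)
Lemma log_derivative_mom X Y : uniq X -> size X = (size Y).+1 ->
  mom X Y 0 = 1 /\ log_derivative (fun m => pow_sum X m - pow_sum Y m) (mom X Y).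
Proof.
move=> uX szX; set n := size Y in szX.
(* With only part of the numerator present, the expansion starts at order [n - size Z]. Shifting by
   that amount keeps the constant term 1 while factors are added one at a time. *)
have gen Z : (size Z <= n)%N -> [/\ forall j, (j < n - size Z)%N -> mom X Z j = 0,
    mom X Z (n - size Z)%N = 1 &
    log_derivative (fun m => pow_sum X m - pow_sum Z m) (fun d => mom X Z (d + (n - size Z))%N)].
  elim: Z => [_|z Z IH /= lt_Z].
    rewrite subn0; split=> [j lt_j||].
    - by rewrite mom_low // szX //=; [rewrite ltn_eqF | lia].
    - by rewrite mom_low // szX //= eqxx.
    - have := log_derivative_mom_nil uX; rewrite szX => /(_ isT).
      by apply: log_derivative_ext => // m; rewrite /pow_sum [X in _ - X]big_nil subr0.
  have [Z0 Z1 RZ] := IH (ltnW lt_Z).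
  have En : (n - size Z = (n - (size Z).+1).+1)%N by lia.
  have E1 : mom X (z :: Z) (n - (size Z).+1) = 1.
    by rewrite mom_consY -En Z1 Z0 ?mulr0 ?subr0 // En.
  split=> // [j lt_j|].
    by rewrite mom_consY !Z0 ?mulr0 ?subr0 //; lia.
  have R : log_derivative (fun m => pow_sum X m - pow_sum Z m - z ^+ m)
      (fun d => mom X (z :: Z) (d + (n - (size Z).+1))%N).
    apply: log_derivative_mul RZ _ _ => [|e] /=; first by rewrite !add0n Z1.
    by rewrite mom_consY En addSn !addnS.
  by apply: log_derivative_ext R => // m; rewrite /pow_sum [X in _ = _ - X]big_cons; ring.
have [_] := gen Y (leqnn _); rewrite subnn => E R; split=> //.
by apply: log_derivative_ext R => // d; rewrite addn0.
Qed.

End Moments.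

(** * Transition probabilities *)

Definition hookprod (K : nat) (a : int -> bool) : rat :=
  \prod_(y <- zr K | ~~ a y) \prod_(x <- zr K | a x && (x < y)) (y - x)%:~R.

Lemma hook_product_word s c K : is_part s -> (extent s + absz c <= K)%N ->
  (hook_product s)%:R = hookprod K (fun x => bword s (x - c)).
Proof.
move=> ps le_K; rewrite /hook_product natr_prod.
rewrite (@big_hooks _ _ _ s c K (fun n => n%:R : rat) ps le_K).
apply: eq_bigr => y _; apply: eq_bigr => x /andP[_ lt_xy].
by rewrite -[_%:R]/((_ : nat)%:Z%:~R); congr (_%:~R); lia.
Qed.

(* Both words agree off {k, k + 1}, so in the quotient of the two hook products
   only pairs involving k or k + 1 survive. *)
Definition pair_hook (a : int -> bool) (x y : int) : rat :=
  if [&& a x, ~~ a y & x < y] then (y - x)%:~R else 1.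

Lemma pair_hook_neq0 a x y : pair_hook a x y != 0.
Proof.
rewrite /pair_hook; case: and3P => [[_ _ lt]|_]; last exact: oner_neq0.
by rewrite intr_eq0 subr_eq0 gt_eqF.
Qed.

(** The assumption on k and k + 1 covers both words: before the move this pair is no hook, after it
    the pair is a hook of length 1. *)
Lemma hookprod_split K a (k : int) : k \in zr K -> k + 1 \in zr K ->
    pair_hook a k (k + 1) = 1 ->
  let W := [seq x <- zr K | (x != k) && (x != k + 1)] in
  hookprod K a = (\prod_(y <- W) \prod_(x <- W) pair_hook a x y) *
   \prod_(x <- W) (pair_hook a x k * pair_hook a x (k + 1) *
     pair_hook a k x * pair_hook a (k + 1) x).
Proof.
move=> kK k1K Ek W.
have pe : perm_eq (zr K) (k :: k + 1 :: W).
  apply: uniq_perm; rewrite ?uniq_zr //=.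
    by rewrite inE !mem_filter !eqxx /= andbF /= filter_uniq ?uniq_zr // !andbT; lia.
  by move=> x; rewrite !inE mem_filter; case: eqP => [->|_] //=; case: eqP => [->|].
have -> : hookprod K a = \prod_(y <- k :: k + 1 :: W) \prod_(x <- k :: k + 1 :: W) pair_hook a x y.
  rewrite /hookprod big_mkcond (perm_big _ pe) /=; apply: eq_bigr => y _.
  rewrite -(perm_big _ pe) /= /pair_hook; case: (a y) => /=.
    by rewrite big1 // => x _; rewrite andbF.
  by rewrite big_mkcond; apply: eq_bigr => x _.
have E0 x y : y <= x -> pair_hook a x y = 1.
  by move=> le; rewrite /pair_hook ltNge le !andbF.
rewrite !big_cons Ek !E0 ?lexx ?lerDl // !mul1r.
have -> : \prod_(y <- W) \prod_(x <- k :: k + 1 :: W) pair_hook a x y =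
    \prod_(y <- W) (pair_hook a k y * pair_hook a (k + 1) y * \prod_(x <- W) pair_hook a x y).
  by apply: eq_bigr => y _; rewrite !big_cons mulrA.
rewrite !big_split /=; ring.
Qed.

Lemma prod_telescope (M : rat) n : (forall i, (i < n)%N -> M - i%:R != 0) -> M != 0 ->
  \prod_(i <- iota 0 n) ((M - 1 - i%:R) / (M - i%:R)) = (M - n%:R) / M.
Proof.
move=> nz M0; elim: n nz => [|n IH] nz; first by rewrite big_nil subr0 divff.
rewrite -addn1 iotaD big_cat big_seq1 /= IH => [|i lt_i]; last by apply: nz; lia.
have nzn := nz n (ltnSn _).
rewrite add0n natrD; field; by rewrite M0 nzn.
Qed.

Lemma prod_below K k : k \in zr K ->
  \prod_(x <- zr K | x < k) ((k - x)%:~R / (k + 1 - x)%:~R) = ((k + 1 + K%:Z)%:~R)^-1 :> rat.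
Proof.
rewrite mem_zr => kK; set n := absz (k + K%:Z).
have En : n%:Z = k + K%:Z by rewrite /n; lia.
have -> : \prod_(x <- zr K | x < k) ((k - x)%:~R / (k + 1 - x)%:~R) =
   \prod_(i <- iota 0 n) (((n.+1)%:R - 1 - i%:R) / ((n.+1)%:R - i%:R)) :> rat.
  rewrite /zr big_map -(big_filter _ (fun i : nat => i%:Z - K%:Z < k)).
  have le_n : (n <= K + K)%N by lia.
  rewrite (eq_filter (a2 := fun i => (i < 0 + n)%N)) ?filter_iota_ltn // => [|i]; last first.
    by clear -En; lia.
  apply: eq_bigr => i _.
  have -> : k - (i%:Z - K%:Z) = n%:Z - i%:Z by rewrite En; ring.
  have -> : k + 1 - (i%:Z - K%:Z) = n.+1%:Z - i%:Z by rewrite intS En; ring.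
  by rewrite !intrB -!pmulrn -natr1 addrK.
rewrite prod_telescope ?pnatr_eq0 //; last first.
  by move=> i lt_i; rewrite subr_eq0 eqr_nat; lia.
have -> : k + 1 + K%:Z = n.+1%:Z by rewrite intS En; ring.
by rewrite -pmulrn -natr1 addrAC subrr add0r div1r.
Qed.

(** A 1 at x < k contributes (k - x) / (k + 1 - x), a 0 at x > k + 1 contributes (k + 1 - x) / (k -
    x), all others 1. Giving the first factor to every x < k, whether 0 or 1, leaves a product over
    the 0's alone; what was added telescopes to [1 / (k + 1 + K)]. *)
Lemma hookprod_moved K a a' k : moved a a' k -> k \in zr K -> k + 1 \in zr K ->
  hookprod K a / hookprod K a' =
  (\prod_(b <- zr K | ~~ a b && (b != k)) ((k + 1 - b)%:~R / (k - b)%:~R))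
     / (k + 1 + K%:Z)%:~R.
Proof.
case=> ak ak1 Ea kK k1K; have := kK; rewrite mem_zr => kK'.
have a'k : a' k by rewrite Ea eqxx.
have a'k1 : a' (k + 1) = false by rewrite Ea eqxx /=; lia.
rewrite (hookprod_split kK k1K); last by rewrite /pair_hook ak.
rewrite (hookprod_split kK k1K); last first.
  by rewrite /pair_hook a'k a'k1 ltrDl ltr01 /= addrAC subrr add0r.
set W := filter _ _; rewrite -mulf_div.
have EW x : x \in W -> [/\ a' x = a x, x != k & x != k + 1].
  by rewrite mem_filter => /andP[/andP[n1 n2] _]; rewrite Ea (negPf n1) n2.
have -> : \prod_(y <- W) \prod_(x <- W) pair_hook a' x y =
    \prod_(y <- W) \prod_(x <- W) pair_hook a x y.
  apply: eq_big_seq => y /EW[Ey _ _]; apply: eq_big_seq => x /EW[Ex _ _].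
  by rewrite /pair_hook Ey Ex.
rewrite divff ?mul1r; last first.
  rewrite prodf_seq_neq0; apply/allP => y _; apply/implyP => _.
  by rewrite prodf_seq_neq0; apply/allP => x _; rewrite pair_hook_neq0.
rewrite -(prod_below kK).
have -> : \prod_(x <- zr K | x < k) ((k - x)%:~R / (k + 1 - x)%:~R) =
   \prod_(x <- W | x < k) ((k - x)%:~R / (k + 1 - x)%:~R) :> rat.
  rewrite /W [RHS]big_filter_cond; apply: eq_bigl => x; clear; lia.
have -> : \prod_(b <- zr K | ~~ a b && (b != k)) ((k + 1 - b)%:~R / (k - b)%:~R) =
   \prod_(b <- W | ~~ a b) ((k + 1 - b)%:~R / (k - b)%:~R) :> rat.
  rewrite /W [RHS]big_filter_cond; apply: eq_bigl => x.
  by have [->|_] := eqVneq x (k + 1); rewrite ?ak1 ?andbF // andbT andbC.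
rewrite -prodf_div (big_mkcond (fun b => ~~ a b)) (big_mkcond (fun x => x < k)) -big_split /=.
apply: eq_big_seq => x /EW[Ex n1 n2].
have N (m : int) : m != 0 -> m%:~R != 0 :> rat by rewrite intr_eq0.
rewrite /pair_hook Ex ak ak1 a'k a'k1 /= ?andbF /= ?andbT.
have [lt_k|] := ltrP x k.
  rewrite (_ : x < k + 1); last by clear -lt_k; lia.
  rewrite (_ : k < x = false); last by clear -lt_k; lia.
  rewrite (_ : k + 1 < x = false); last by clear -lt_k; lia.
  have h1 := N (k + 1 - x) ltac:(clear -lt_k; lia); have h2 := N (k - x) ltac:(clear -lt_k; lia).
  move: h1 h2; move: (k + 1 - x)%:~R (k - x)%:~R => p q h1 h2.
  by case: (a x) => /=; field; rewrite ?h1 ?h2.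
move=> ge_k; have {ge_k}lt_k : k + 1 < x by clear -ge_k n1 n2; lia.
rewrite lt_k (_ : x < k + 1 = false); last by clear -lt_k; lia.
rewrite (_ : k < x); last by clear -lt_k; lia.
have h1 := N (x - k) ltac:(clear -lt_k; lia); have h2 := N (k - x) ltac:(clear -lt_k; lia).
case: (a x) => /=; first by field.
rewrite (_ : x - k = - (k - x)); last by ring.
rewrite (_ : x - (k + 1) = - (k + 1 - x)); last by ring.
move: h2; rewrite !mulrNz; move: (k + 1 - x)%:~R (k - x)%:~R => p q h2.
by field.
Qed.

(** By the hook length formula this is f(nu) / ((n + 1) f(mu)), with f counting standard tableaux,
    mu and nu the quotient before and after the move and n the size of mu: the Plancherel transition
    probability. *)
Definition transition (t : nat) (s : seq nat) (i : nat) (k : int) : rat :=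
  (hook_product (quotient t s i))%:R / (hook_product (quotient t (add_strip t s i k) i))%:R.

Definition moment (t : nat) (s : seq nat) (i d : nat) : rat :=
  \sum_(k <- addable t s i) transition t s i k * k%:~R ^+ d.

Lemma hookprod_eq K a a' : a =1 a' -> hookprod K a = hookprod K a'.
Proof.
by move=> E; apply: eq_big => y; rewrite ?E // => _; apply: eq_bigl => x; rewrite E.
Qed.

(* X is the set of 0's in a window starting in the region of 0's, and Y is X
   without its least element, shifted by -1: the residue at a 0 that cannot move
   vanishes, the other residues are the transition probabilities. *)
Lemma moment_mom t s i : self_conj s -> ~~ odd t -> (i < t./2)%N ->
  exists2 K, (extent s < K)%N &
    forall d, moment t s i d =
     mom [seq x%:~R | x <- zr K & ~~ subword t s i x]
         [seq (x - 1)%:~R | x <- zr K & ~~ subword t s i x && (x != - K%:Z)] d.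
Proof.
move=> sc et lt_i; have ps := self_conj_part sc; have lt_it := half_lt lt_i.
have [pq bq] := quotientP ps lt_it; set a := subword t s i in bq *.
have va : vac_outside a (extent s) := subword_vac ps lt_it.
(* One window has to serve the word before the move and the words after every possible move, hence
   the sum over [addable]. *)
pose K := (extent s + extent (quotient t s i) + absz (charge t s i) +
  \sum_(k <- addable t s i) extent (quotient t (add_strip t s i k) i)).+1.
have ltK : (extent s < K)%N by rewrite /K; clear; lia.
have leK : (extent (quotient t s i) + absz (charge t s i) <= K)%N.
  by rewrite /K; move: (\sum_(_ <- _) _)%N; clear; lia.
have leK' k : k \in addable t s i ->
    (extent (quotient t (add_strip t s i k) i) + absz (charge t s i) <= K)%N.
  move=> kP; rewrite /K (bigD1_seq k kP) ?filter_uniq ?uniq_zr //=.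
  by move: (\sum_(_ <- _ | _) _)%N; clear; lia.
clearbody K; exists K => //.
move=> d; rewrite /moment /mom !big_map.
have lowK : - K%:Z \in zr K by rewrite mem_zr; move: ltK; clear; lia.
have alow : a (- K%:Z) = false by apply: (va _).1; move: ltK; clear; lia.
(* If k + 1 is also a 0, then k occurs among the 0's shifted by -1, and the numerator of the residue
   at k is zero. *)
rewrite [RHS]big_filter [RHS](bigID (fun x => a (x + 1))) /=
  [X in _ + X]big1_seq ?addr0; last first.
  move=> k /andP[/andP[ak ak1]]; rewrite mem_zr => kK.
  have k1K : k + 1 \in [seq x <- zr K | ~~ a x && (x != - K%:Z)].
    rewrite mem_filter ak1 mem_zr /=; apply/andP; split; first by clear -kK; lia.
    have : ~ ((extent s)%:Z <= k + 1) by move/(va _).2; apply/negP.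
    by move: kK ltK; clear; lia.
  by rewrite big_map (bigD1_seq _ k1K) ?filter_uniq ?uniq_zr //= addrK subrr !mul0r.
rewrite -[RHS]big_filter.
have pe : perm_eq (addable t s i) [seq x <- zr K | ~~ a x & a (x + 1)].
  apply: uniq_perm; rewrite ?filter_uniq ?uniq_zr // => x.
  rewrite (mem_addable _ ps lt_it) mem_filter mem_zr -/a.
  case Eb: (~~ a x && a (x + 1)) => //=; case/andP: Eb => ax ax1.
  have h1 : ~ (x + 1 < - (extent s)%:Z) by move/(va _).1; rewrite ax1.
  have h2 : ~ ((extent s)%:Z <= x) by move/(va _).2; apply/negP.
  by symmetry; move: h1 h2 ltK; clear; lia.
rewrite -(perm_big _ pe); apply: eq_big_seq => k kP; congr (_ * _).
have := kP; rewrite (mem_addable _ ps lt_it) => /andP[/negbTE ak ak1].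
have kK : k \in zr K by have := kP; rewrite (perm_mem pe) mem_filter => /andP[].
have k1K : k + 1 \in zr K.
  have : ~ ((extent s)%:Z <= k) by move/(va _).2; rewrite /a ak.
  by move: kK ltK; rewrite !mem_zr; clear; lia.
have [S _ _] := add_stripP sc et lt_i ak ak1.
set r := add_strip t s i k in S *.
have pr := self_conj_part (step_sc S).
have [pq' bq'] := quotientP pr lt_it.
rewrite /transition -/r (@hook_product_word _ (charge t s i) K pq leK).
rewrite (@hook_product_word _ (charge t s i) K pq' (leK' k kP)).
rewrite (hookprod_eq _ (fun x => esym (bq x))).
rewrite (@hookprod_eq _ (fun x => bword (quotient t r i) _) (subword t r i)); last first.
  by move=> x; rewrite bq' (step_charge S lt_it).
rewrite (hookprod_moved (step_moved S)) // -/a.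
rewrite [X in _ = X / _]big_map [X in _ = _ / X]big_map [X in _ = _ / X]big_filter_cond.
rewrite prodf_div -mulrA -invfM.
set D := \prod_(b <- zr K | _) (k - b)%:~R.
have -> : \prod_(x <- zr K | ~~ a x && (x%:~R != k%:~R :> rat)) (k%:~R - x%:~R) = D.
  by apply: eq_big => x; rewrite ?eqr_int // intrB.
(* Splitting off the lowest 0, at - [K], yields the factor k + 1 + K that cancels the boundary
   factor of [hookprod_moved]; the other 0's, shifted, are the y's. *)
have -> : \prod_(x <- zr K | ~~ a x && (x != k)) (k + 1 - x)%:~R =
   (k + 1 + K%:Z)%:~R *
   \prod_(x <- [seq x <- zr K | ~~ a x && (x != - K%:Z)]) (k%:~R - (x - 1)%:~R) :> rat.
  transitivity (\prod_(x <- zr K | ~~ a x) (k + 1 - x)%:~R : rat).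
    rewrite [RHS](bigID (fun x => x != k)) /= [X in _ * X]big1 ?mulr1 // => x /andP[_].
    by rewrite negbK => /eqP->; rewrite addrAC subrr add0r.
  rewrite -[LHS]big_filter (bigD1_seq (- K%:Z)) ?filter_uniq ?uniq_zr ?mem_filter ?alow //=.
  rewrite opprK; congr (_ * _); rewrite [LHS]big_filter_cond [RHS]big_filter.
  by apply: eq_bigr => x _; rewrite -intrB; congr (_%:~R); ring.
have nz : (k + 1 + K%:Z)%:~R != 0 :> rat.
  by rewrite intr_eq0; move: kK; rewrite mem_zr; clear; lia.
by rewrite [D * _]mulrC invfM mulrACA mulfV // mul1r.
Qed.

(** The difference of power sums is the sum of x^m - (x - 1)^m over the 0's plus (-K - 1)^m, as the
    lowest 0 has no shifted partner. Passing to the signed sum subtracts a telescoping sum, which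
    trades that term for (-1)^m and eliminates the window. *)
Lemma moment_log t s i : self_conj s -> ~~ odd t -> (i < t./2)%N ->
  moment t s i 0 = 1 /\
  log_derivative (fun m => wsum (extent s) (subword t s i)
      (fun x => x%:~R ^+ m - (x - 1)%:~R ^+ m) + (-1) ^+ m) (moment t s i).
Proof.
move=> sc et lt_i; have ps := self_conj_part sc; have lt_it := half_lt lt_i.
have [K lt_K EM] := moment_mom sc et lt_i.
have va := subword_vac ps lt_it.
set a := subword t s i in va EM *.
set X := map _ _ in EM; set Y := map _ _ in EM.
have lowK : - K%:Z \in zr K by rewrite mem_zr; move: lt_K; clear; lia.
have alow : a (- K%:Z) = false by apply: (va _).1; move: lt_K; clear; lia.
have pe : perm_eq [seq x <- zr K | ~~ a x] (- K%:Z :: [seq x <- zr K | ~~ a x && (x != - K%:Z)]).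
  apply: uniq_perm; rewrite ?filter_uniq ?uniq_zr //=.
    by rewrite mem_filter eqxx andbF filter_uniq ?uniq_zr.
  by move=> x; rewrite inE !mem_filter; have [->|] := eqVneq x (- K%:Z); rewrite ?alow ?lowK ?andbT.
have szX : size X = (size Y).+1 by rewrite !size_map (perm_size pe).
have uX : uniq X by rewrite map_inj_uniq ?filter_uniq ?uniq_zr //; exact: intr_inj.
have [M0 ML] := log_derivative_mom uX szX.
split; first by rewrite EM.
apply: log_derivative_ext (fun d => esym (EM d)) ML => m.
rewrite -(wsum_stable _ va (ltnW lt_K)) wsumE sum_vac_zeros.
rewrite /pow_sum /X /Y [X in X - _]big_map [X in _ - X]big_map.
have -> : \sum_(r <- iota 0 K) ((- r.+1%:Z)%:~R ^+ m - (- r.+1%:Z - 1)%:~R ^+ m) =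
   (-1) ^+ m - (- K%:Z - 1)%:~R ^+ m :> rat.
  elim: (K) => [|n IH]; first by rewrite big_nil oppr0 add0r subrr.
  rewrite -addn1 iotaD big_cat big_seq1 /= IH add0n addn1.
  by rewrite (_ : - n%:Z - 1 = - n.+1%:Z); [ring | lia].
have E : \sum_(x <- [seq x <- zr K | ~~ a x]) (x - 1)%:~R ^+ m = (- K%:Z - 1)%:~R ^+ m +
    \sum_(x <- [seq x <- zr K | ~~ a x && (x != - K%:Z)]) (x - 1)%:~R ^+ m :> rat.
  by rewrite (perm_big _ pe) big_cons.
rewrite -[in RHS]big_filter sumrB E; ring.
Qed.

(** * Weights *)

Definition class_sum (t i : nat) (f : {poly rat}) (s : seq nat) : rat :=
  wsum (extent s) (subword t s i) (fun x => f.[x%:~R]).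

(* [fil t w] : functions of weight at most w, where the class sum of a polynomial
   of degree d has weight d + 1. *)
Inductive fil (t : nat) : nat -> (seq nat -> rat) -> Prop :=
| fil_const w c : fil t w (fun=> c)
| fil_class i (f : {poly rat}) w : (i < t)%N -> (size f <= w)%N -> fil t w (class_sum t i f)
| fil_add w g h : fil t w g -> fil t w h -> fil t w (fun s => g s + h s)
| fil_mul w1 w2 w g h : fil t w1 g -> fil t w2 h -> (w1 + w2 <= w)%N ->
    fil t w (fun s => g s * h s)
| fil_ext w g h : fil t w g -> (forall s, self_conj s -> h s = g s) -> fil t w h.

Lemma fil_le t w w' g : fil t w g -> (w <= w')%N -> fil t w' g.
Proof.
move=> fg; elim: fg w' => {w g}
  [w c|i f w lt_i le_f|w g h _ IHg _ IHh|w1 w2 w g h fg _ fh _ le_w|w g h _ IH E] w' le.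
- exact: fil_const.
- by apply: fil_class => //; exact: leq_trans le.
- by apply: fil_add; [exact: IHg | exact: IHh].
- by apply: fil_mul fg fh _; exact: leq_trans le.
- exact: fil_ext (IH _ le) E.
Qed.

Lemma fil_scale t w c g : fil t w g -> fil t w (fun s => c * g s).
Proof. by move=> fg; apply: fil_mul (fil_const t 0 c) fg _. Qed.

Lemma fil_sum t w I (r : seq I) (P : pred I) (g : I -> seq nat -> rat) :
  (forall i, P i -> fil t w (g i)) -> fil t w (fun s => \sum_(i <- r | P i) g i s).
Proof.
move=> fg; elim: r => [|i r IH].
  by apply: fil_ext (fil_const t w 0) _ => s _; rewrite big_nil.
have [Pi|nPi] := boolP (P i).
  by apply: fil_ext (fil_add (fg i Pi) IH) _ => s _; rewrite big_cons Pi.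
by apply: fil_ext IH _ => s _; rewrite big_cons (negPf nPi).
Qed.

Lemma fil_sum_seq t w (I : eqType) (r : seq I) (g : I -> seq nat -> rat) :
  (forall i, i \in r -> fil t w (g i)) -> fil t w (fun s => \sum_(i <- r) g i s).
Proof.
elim: r => [|i r IH] fg.
  by apply: fil_ext (fil_const t w 0) _ => s _; rewrite big_nil.
have fi := fg i (mem_head _ _).
have fr : fil t w (fun s => \sum_(i <- r) g i s).
  by apply: IH => j jr; apply: fg; rewrite inE jr orbT.
by apply: fil_ext (fil_add fi fr) _ => s _; rewrite big_cons.
Qed.

Lemma fil_prod t n (w : 'I_n -> nat) (g : 'I_n -> seq nat -> rat) :
  (forall i, fil t (w i) (g i)) -> fil t (\sum_(i < n) w i)%N (fun s => \prod_(i < n) g i s).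
Proof.
move=> fg; suff: fil t (\sum_(i <- enum 'I_n) w i)%N (fun s => \prod_(i <- enum 'I_n) g i s).
  by rewrite big_enum => H; apply: fil_ext H _ => s _; rewrite big_enum.
elim: (enum _) => [|i r IH].
  by apply: fil_ext (fil_const t _ 1) _ => s _; rewrite big_nil.
by rewrite big_cons; apply: fil_ext (fil_mul (fg i) IH (leqnn _)) _ => s _; rewrite big_cons.
Qed.

Lemma size_poly_diff (f : {poly rat}) : (size (f \Po ('X + 1) - f)%R <= (size f).-1)%N.
Proof.
have sz1 : size ('X + 1 : {poly rat}) = 2%N by rewrite size_XaddC.
have [->|f0] := eqVneq f 0; first by rewrite comp_poly0 subrr size_poly0.
have szc : size (f \Po ('X + 1)) = size f by rewrite size_comp_poly2.
apply/leq_sizeP => j le_j; rewrite coefB.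
have [lt_j|] := ltnP (size f).-1 j.
  by rewrite !nth_default ?subrr ?szc //; rewrite -ltnS prednK ?lt0n ?size_poly_eq0 in lt_j *.
move=> le_j'; have -> : j = (size f).-1 by apply/eqP; rewrite eqn_leq le_j le_j'.
rewrite -{1}szc -[(f \Po _)`__]/(lead_coef _) -[f`__]/(lead_coef _) lead_coef_comp ?sz1 //.
by rewrite lead_coefXaddC expr1n mulr1 subrr.
Qed.

Lemma horner_poly_diff (f : {poly rat}) x : (f \Po ('X + 1) - f).[x] = f.[x + 1] - f.[x].
Proof. by rewrite !hornerE horner_comp !hornerE. Qed.

(* [dfil t i W] : functions of s and of the moving position k whose total weight
   is at most W - 2, a polynomial of degree d in k having weight d. *)
Inductive dfil (t i : nat) : nat -> (seq nat -> int -> rat) -> Prop :=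
| dfil_base w g (q : {poly rat}) W : fil t w g -> (w + (size q).+1 <= W)%N ->
    dfil t i W (fun s k => g s * q.[k%:~R])
| dfil_zero W : dfil t i W (fun _ _ => 0)
| dfil_add W g h : dfil t i W g -> dfil t i W h -> dfil t i W (fun s k => g s k + h s k)
| dfil_ext W g h : dfil t i W g ->
    (forall s k, self_conj s -> k \in addable t s i -> h s k = g s k) -> dfil t i W h.

Lemma dfil_le t i W W' h : dfil t i W h -> (W <= W')%N -> dfil t i W' h.
Proof.
move=> dh; elim: dh W' => {W h} [w g q W fg le_W|W|W g h _ IHg _ IHh|W g h _ IH E] W' le.
- by apply: dfil_base fg _; exact: leq_trans le.
- exact: dfil_zero.
- by apply: dfil_add; [exact: IHg | exact: IHh].
- exact: dfil_ext (IH _ le) E.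
Qed.

Lemma dfil_mulf t i w W f h : fil t w f -> dfil t i W h ->
  dfil t i (w + W) (fun s k => f s * h s k).
Proof.
move=> ff; elim=> {W h} [w' g q W fg le_W|W|W g h _ IHg _ IHh|W g h _ IH E].
- have le : (w + w' + (size q).+1 <= w + W)%N by rewrite -addnA leq_add2l.
  by apply: dfil_ext (dfil_base i (fil_mul ff fg (leqnn _)) le) _ => s k _ _; rewrite mulrA.
- by apply: dfil_ext (dfil_zero t i _) _ => s k _ _; rewrite mulr0.
- by apply: dfil_ext (dfil_add IHg IHh) _ => s k _ _; rewrite mulrDr.
- by apply: dfil_ext IH _ => s k sc kP; rewrite E.
Qed.

Lemma dfil_mul t i W W' g h : dfil t i W g -> dfil t i W' h ->
  dfil t i (W + W') (fun s k => g s k * h s k).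
Proof.
move=> dg dh; elim: dg => {W g} [w g q W fg le_W|W|W g g' _ IHg _ IHg'|W g g' _ IH E]; last first.
- by apply: dfil_ext IH _ => s k sc kP; rewrite E.
- by apply: dfil_ext (dfil_add IHg IHg') _ => s k _ _; rewrite mulrDl.
- by apply: dfil_ext (dfil_zero t i _) _ => s k _ _; rewrite mul0r.
elim: dh => {W' h} [w' h q' W' fh le_W'|W'|W' h h' _ IHh _ IHh'|W' h h' _ IH E]; last first.
- by apply: dfil_ext IH _ => s k sc kP; rewrite E.
- by apply: dfil_ext (dfil_add IHh IHh') _ => s k _ _; rewrite mulrDr.
- by apply: dfil_ext (dfil_zero t i _) _ => s k _ _; rewrite mulr0.
have le : (w + w' + (size (q * q')%R).+1 <= W + W')%N.
  by have := size_polyMleq q q'; move: le_W le_W'; clear; lia.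
by apply: dfil_ext (dfil_base i (fil_mul fg fh (leqnn _)) le) _ => s k _ _; rewrite hornerM; ring.
Qed.

Lemma class_sum_add_strip t s i k j f : self_conj s -> ~~ odd t -> (i < t./2)%N ->
    k \in addable t s i -> (j < t)%N ->
  class_sum t j f (add_strip t s i k) - class_sum t j f s =
  if j == i then f.[k%:~R + 1] - f.[k%:~R]
  else if j == (t - i.+1)%N then f.[- 2%:R - k%:~R + 1] - f.[- 2%:R - k%:~R] else 0.
Proof.
move=> sc et lt_i kP lt_j; have ps := self_conj_part sc.
have := kP; rewrite (mem_addable _ ps (half_lt lt_i)) => /andP[/negbTE ak ak1].
have [S _ _] := add_stripP sc et lt_i ak ak1.
have pr := self_conj_part (step_sc S).
rewrite /class_sum; set r := add_strip t s i k in S pr *.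
pose K := (extent s + extent r + `|k| + 4)%N.
have ltK : (extent s <= K)%N by rewrite /K; clear; lia.
have ltK' : (extent r <= K)%N by rewrite /K; clear; lia.
have kK : [/\ k \in zr K, k + 1 \in zr K, - 2%:Z - k \in zr K & - 2%:Z - k + 1 \in zr K].
  by split; rewrite mem_zr /K; move: (extent s) (extent r); clear; lia.
case: kK => kK1 kK2 kK3 kK4; clearbody K.
rewrite -(wsum_stable _ (subword_vac ps lt_j) ltK) -(wsum_stable _ (subword_vac pr lt_j) ltK').
case: eqP => [->|/eqP ni].
  by rewrite (wsum_moved _ (step_moved S)) // intrD.
case: eqP => [->|/eqP ni'].
  by rewrite (wsum_moved _ (step_mirror S)) // intrD intrB mulrNz.
by rewrite (wsum_eq (g := fun x => f.[x%:~R]) K (step_other S lt_j ni ni') (fun=> erefl)) subrr.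
Qed.

(** Induction on the derivation of the weight. Class sums change in the class of the moving 0 and in
    its mirror class; products follow from D(gh) = g Dh + h Dg + Dg Dh, each term of which stays
    within the bound. *)
Lemma fil_delta t W g i : fil t W g -> ~~ odd t -> (i < t./2)%N ->
  dfil t i W (fun s k => g (add_strip t s i k) - g s).
Proof.
move=> fg et lt_i; elim: fg => {W g}
  [w c|j f w lt_j le_f|w g h _ IHg _ IHh|w1 w2 w g h fg IHg fh IHh le_w|w g h _ IH E].
- by apply: dfil_ext (dfil_zero t i _) _ => s k _ _; rewrite subrr.
- have [f0|f0] := eqVneq f 0.
    apply: dfil_ext (dfil_zero t i _) _ => s k _ _.
    by rewrite f0 /class_sum /wsum !big1 ?subrr // => x _; rewrite horner0 mulr0.
  have szf : (0 < size f)%N by rewrite lt0n size_poly_eq0.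
  have szq := size_poly_diff f.
  have [Ej|nj] := eqVneq j i.
    have le : (0 + (size (f \Po ('X + 1) - f)%R).+1 <= w)%N.
      by move: szq szf le_f; clear; lia.
    apply: dfil_ext (dfil_base i (fil_const t 0 1) le) _ => s k sc kP.
    by rewrite class_sum_add_strip // Ej eqxx mul1r horner_poly_diff.
  have [Ej|nj'] := eqVneq j (t - i.+1)%N.
    (* In the mirror class the 0 moves from -2 - k to -1 - k, so the difference polynomial is
       evaluated at -2 - k. *)
    pose q := (f \Po ('X + 1) - f) \Po (- 2%:R%:P - 'X).
    have szl : size (- 2%:R%:P - 'X : {poly rat}) = 2%N.
      by rewrite -opprD size_polyN addrC size_XaddC.
    have szq' : (size q <= (size f).-1)%N by rewrite /q size_comp_poly2.
    have le : (0 + (size q).+1 <= w)%N by move: szq' szf le_f; clear; lia.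
    apply: dfil_ext (dfil_base i (fil_const t 0 1) le) _ => s k sc kP.
    rewrite class_sum_add_strip // (negPf nj) Ej eqxx mul1r.
    by rewrite /q horner_comp horner_poly_diff !hornerE.
  apply: dfil_ext (dfil_zero t i _) _ => s k sc kP.
  by rewrite class_sum_add_strip // (negPf nj) (negPf nj').
- by apply: dfil_ext (dfil_add IHg IHh) _ => s k _ _; ring.
- have d1 := dfil_le (dfil_mulf fg IHh) le_w.
  have le_w' : (w2 + w1 <= w)%N by rewrite addnC.
  have d2 := dfil_le (dfil_mulf fh IHg) le_w'.
  have d3 := dfil_le (dfil_mul IHg IHh) le_w.
  by apply: dfil_ext (dfil_add (dfil_add d1 d2) d3) _ => s k _ _; ring.
- apply: dfil_ext IH _ => s k sc kP; have ps := self_conj_part sc.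
  have := kP; rewrite (mem_addable _ ps (half_lt lt_i)) => /andP[/negbTE ak ak1].
  have [S _ _] := add_stripP sc et lt_i ak ak1.
  by rewrite !E //; exact: step_sc S.
Qed.

Lemma moment_fil t i d : ~~ odd t -> (i < t./2)%N -> fil t d (fun s => moment t s i d).
Proof.
move=> et lt_i; elim/ltn_ind: d => -[_|d IH].
  by apply: fil_ext (fil_const t 0 1) _ => s sc; have [] := moment_log sc et lt_i.
(* This is X^(m + 1) - (X - 1)^(m + 1), written as a forward difference so that [size_poly_diff]
   bounds its degree by m. *)
pose f m : {poly rat} := (('X - 1) ^+ m.+1 \Po ('X + 1)) - ('X - 1) ^+ m.+1.
have fK m : fil t m.+1 (fun s => class_sum t i (f m) s + (-1) ^+ m.+1).
  apply: fil_add (fil_const _ _ _); apply: fil_class; first exact: half_lt.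
  by apply: leq_trans (size_poly_diff _) _; rewrite size_exp_XsubC.
have fS : fil t d.+1 (fun s => (d.+1%:R)^-1 * \sum_(m < d.+1)
    (class_sum t i (f m) s + (-1) ^+ m.+1) * moment t s i (d - m)).
  apply: fil_scale; apply: fil_sum => m _.
  have lt_m : (d - m < d.+1)%N by rewrite ltnS leq_subr.
  by apply: fil_mul (fK m) (IH _ lt_m) _; rewrite addSn subnKC // -ltnS.
apply: fil_ext fS _ => s sc; have [_ /(_ d.+1) R] := moment_log sc et lt_i.
apply: (mulfI (_ : d.+1%:R != 0)); first by rewrite pnatr_eq0.
rewrite R mulVKf ?pnatr_eq0 // /conv; apply: eq_bigr => m _; rewrite subSS; congr ((_ + _) * _).
apply: wsum_eq => // x; rewrite /f !hornerE horner_comp !hornerE addrK.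
by rewrite intrB.
Qed.

Definition average (t i : nat) (h : seq nat -> int -> rat) (s : seq nat) : rat :=
  \sum_(k <- addable t s i) transition t s i k * h s k.

(** Averaging turns k^j into the j-th moment, of the same weight j. The second conjunct is needed
    because [W - 2] is truncated: for W < 2 only q = 0 fits the bound, so the average is 0, and this
    is what ends the iteration of [Dt]. *)
Lemma average_fil t i W h : dfil t i W h -> ~~ odd t -> (i < t./2)%N ->
  fil t (W - 2) (average t i h) /\
  ((W < 2)%N -> forall s, self_conj s -> average t i h s = 0).
Proof.
move=> dh et lt_i; elim: dh => {W h}
  [w g q W fg le_W|W|W g h _ [IHg Zg] _ [IHh Zh]|W g h _ [IH Z] E].
- have E s : average t i (fun s k => g s * q.[k%:~R]) s =
      g s * \sum_(j < size q) q`_j * moment t s i j.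
    rewrite /average /moment mulr_sumr.
    under [RHS]eq_bigr do rewrite !mulr_sumr.
    rewrite [RHS]exchange_big; apply: eq_bigr => k _ /=.
    by rewrite horner_coef mulrCA !mulr_sumr; apply: eq_bigr => j _; ring.
  have [q0|q0] := posnP (size q).
    have E0 s : average t i (fun s k => g s * q.[k%:~R]) s = 0.
      by rewrite E q0 big_ord0 mulr0.
    by split=> [|_ s _]; rewrite ?E0 //; apply: fil_ext (fil_const t _ 0) _ => s _.
  split; last by move: le_W q0; clear; lia.
  apply: fil_ext (fil_mul fg (w2 := (size q).-1) _ _) (fun s _ => E s).
    apply: fil_sum => j _; apply: fil_scale; apply: fil_le (moment_fil j et lt_i) _.
    by have := ltn_ord j; move: q0; clear; lia.
  by move: le_W q0; clear; lia.
- have E s : average t i (fun _ _ => 0) s = 0 by apply: big1 => k _; rewrite mulr0.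
  by split=> [|_ s _]; rewrite ?E //; apply: fil_ext (fil_const t _ 0) _ => s _.
- have E s : average t i (fun s k => g s k + h s k) s = average t i g s + average t i h s.
    by rewrite /average -big_split; apply: eq_bigr => k _; rewrite mulrDr.
  split; first by apply: fil_ext (fil_add IHg IHh) _ => s _; exact: E.
  by move=> lt_W s sc; rewrite E Zg // Zh // addr0.
have E' s : self_conj s -> average t i h s = average t i g s.
  by move=> sc; apply: eq_big_seq => k kP; rewrite E.
split; first exact: fil_ext IH E'.
by move=> lt_W s sc; rewrite E' // Z.
Qed.

(** * Hook and content sums *)

Definition binomial_poly (j : nat) : {poly rat} :=
  (j`!%:R)^-1 *: \prod_(i < j) ('X - i%:R%:P).

Lemma size_binomial_poly j : size (binomial_poly j) = j.+1.
Proof.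
rewrite size_scale ?invr_eq0 ?pnatr_eq0 -?lt0n ?fact_gt0 // -big_enum /=.
by rewrite size_prod_XsubC size_enum_ord.
Qed.

Lemma binomial_poly_diff j x :
  (binomial_poly j.+1).[x + 1] - (binomial_poly j.+1).[x] = (binomial_poly j).[x].
Proof.
rewrite !hornerZ !horner_prod big_ord_recl [in X in _ - X]big_ord_recr /= !hornerE.
rewrite (eq_bigr (fun i : 'I_j => ('X - i%:R%:P).[x])) => [|i _]; last first.
  by rewrite !hornerE /bump /= add1n -natr1; ring.
set P := \prod_(i < j) _; rewrite factS natrM invfM.
have nz : j.+1%:R != 0 :> rat by rewrite pnatr_eq0.
have nz' : j`!%:R != 0 :> rat by rewrite pnatr_eq0 -lt0n fact_gt0.
by move: nz; rewrite /= -natr1 => nz; field; rewrite nz nz'.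
Qed.

(** Newton's expansion by descent on the degree: a multiple of a binomial polynomial cancels the
    leading term, and its antidifference is the next binomial polynomial. *)
Lemma poly_antidifference (p : {poly rat}) :
  exists2 q : {poly rat}, (size q <= (size p).+1)%N & forall x, q.[x + 1] - q.[x] = p.[x].
Proof.
move: {2}(size p) (leqnn (size p)) => n; elim: n p => [|n IH] p le_p.
  exists 0 => [|x]; first by rewrite size_poly0.
  by move: le_p; rewrite leqn0 size_poly_eq0 => /eqP->; rewrite !horner0 subrr.
have [lt_p|ge_p] := ltnP (size p) n.+1; first exact: IH.
have szp : size p = n.+1 by apply/eqP; rewrite eqn_leq le_p ge_p.
have szB := size_binomial_poly n.
have lB : lead_coef (binomial_poly n) != 0 by rewrite lead_coef_eq0 -size_poly_eq0 szB.
pose c := lead_coef p / lead_coef (binomial_poly n).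
have le' : (size (p - c *: binomial_poly n)%R <= n)%N.
  apply/leq_sizeP => j le_j; rewrite coefB coefZ.
  move: le_j; rewrite leq_eqVlt => /predU1P[<-|lt_j].
    have -> : p`_n = lead_coef p by rewrite lead_coefE szp.
    have -> : (binomial_poly n)`_n = lead_coef (binomial_poly n) by rewrite lead_coefE szB.
    by rewrite /c divfK // subrr.
  by rewrite !nth_default ?szp ?szB // mulr0 subrr.
have [q szq Eq] := IH _ le'.
exists (q + c *: binomial_poly n.+1) => [|x].
  rewrite szp (leq_trans (size_polyD _ _)) // geq_max (leq_trans szq) ?ltnS ?(leq_trans le') //.
  by rewrite (leq_trans (size_scale_leq _ _)) // size_binomial_poly.
have := Eq x; rewrite hornerD hornerN hornerZ -binomial_poly_diff => E.
rewrite (hornerD q _ (x + 1)) (hornerD q _ x) !(hornerZ c) opprD addrACA E; ring.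
Qed.

Definition antidifference (f : int -> rat) (x : int) : rat :=
  match x with
  | Posz n => \sum_(i < n) f i.+1%:Z
  | Negz n => - \sum_(i < n.+1) f (- i%:Z)
  end.

Lemma antidifferenceP f x : antidifference f x - antidifference f (x - 1) = f x.
Proof.
case: x => [[|n]|n].
- by rewrite /= big_ord0 big_ord1 opprK add0r oppr0.
- rewrite (_ : n.+1%:Z - 1 = n) /= ?big_ord_recr /=; last by lia.
  by rewrite addrAC subrr add0r.
- rewrite (_ : Negz n - 1 = Negz n.+1); last by lia.
  by rewrite /= [X in _ - - X]big_ord_recr /= opprK addKr NegzE.
Qed.

Lemma int_shift_const (h : int -> rat) : (forall k, h (k + 1) = h k) -> forall k, h k = h 0.
Proof.
move=> E; elim/int_rect => [//|n IH|n IH].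
  by rewrite -IH -(E n%:Z); congr h; lia.
by rewrite -IH -(E (- n.+1%:Z)); congr h; lia.
Qed.

(** With a periodic coefficient the antidifference becomes a polynomial only on each class: its
    increment over a full period is a polynomial in k of degree at most n. The antidifference of
    that polynomial agrees with it up to a constant, read off at k = 0. *)
Lemma antidifference_class t n (c Phi : int -> rat) i :
    (forall x y, c (t%:Z * y + x) = c x) ->
    (forall x, Phi x - Phi (x - 1) = c x * x%:~R ^+ n) ->
  exists2 q : {poly rat}, (size q <= n.+2)%N &
    forall k, Phi (t%:Z * k + i%:Z) = q.[k%:~R].
Proof.
move=> per EPhi.
pose l s : {poly rat} := t%:R *: 'X + ((i + s.+1)%N%:R)%:P.
pose p : {poly rat} := \sum_(s < t) c (i + s.+1)%N%:Z *: l s ^+ n.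
have szp : (size p <= n.+1)%N.
  apply: (leq_trans (size_sum _ _ _)); apply/bigmax_leqP => s _.
  apply: (leq_trans (size_scale_leq _ _)); apply: (leq_trans (size_poly_exp_leq _ _)).
  have : (size (l s) <= 2)%N.
    rewrite (leq_trans (size_polyD _ _)) // geq_max (leq_trans (size_scale_leq _ _)) ?size_polyX //.
    by rewrite (leq_trans (size_polyC_leq1 _)).
  by case: (size _) => [|[|[|]]] //= _; rewrite ?mul0n ?mul1n.
have [q szq Eq] := poly_antidifference p.
have step k : Phi (t%:Z * (k + 1) + i%:Z) - Phi (t%:Z * k + i%:Z) = p.[k%:~R].
  have gen m : Phi (t%:Z * k + i%:Z + m%:Z) - Phi (t%:Z * k + i%:Z) =
      \sum_(s < m) c (i + s.+1)%N%:Z * (l s).[k%:~R] ^+ n.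
    elim: m => [|m IH]; first by rewrite addr0 subrr big_ord0.
    rewrite big_ord_recr /= -IH.
    have -> : c (i + m.+1)%N%:Z * (l m).[k%:~R] ^+ n =
        Phi (t%:Z * k + i%:Z + m.+1%:Z) - Phi (t%:Z * k + i%:Z + m%:Z).
      rewrite (_ : t%:Z * k + i%:Z + m%:Z = t%:Z * k + i%:Z + m.+1%:Z - 1); last by lia.
      rewrite EPhi -addrA -PoszD per; congr (_ * _ ^+ _).
      by rewrite /l !hornerE intrD intrM -!pmulrn.
    ring.
  rewrite (_ : t%:Z * (k + 1) + i%:Z = t%:Z * k + i%:Z + t%:Z); last by ring.
  rewrite gen /p horner_sum; apply: eq_bigr => s _.
  by rewrite hornerZ horner_exp.
pose h (k : int) : rat := Phi (t%:Z * k + i%:Z) - q.[k%:~R].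
have hE : forall k, h k = h 0.
  apply: int_shift_const => k; apply/eqP; rewrite -subr_eq0 /h; apply/eqP.
  have := step k; have := Eq k%:~R; rewrite intrD => <- E.
  by rewrite -[RHS](subrr (q.[k%:~R + 1] - q.[k%:~R])) -{1}E; ring.
exists (q + (h 0)%:P) => [|k].
  rewrite (leq_trans (size_polyD _ _)) // geq_max (leq_trans szq) ?ltnS //.
  by rewrite (leq_trans (size_polyC_leq1 _)).
by rewrite hornerD hornerC -(hE k) /h; ring.
Qed.

Lemma fil_wsum t w (Phi : int -> rat) : (0 < t)%N ->
    (forall i, (i < t)%N -> exists2 q : {poly rat}, (size q <= w)%N &
      forall k, Phi (t%:Z * k + i%:Z) = q.[k%:~R]) ->
  fil t w (fun s => wsum (t * extent s) (bword s) Phi).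
Proof.
move=> t0 EPhi.
have := @fil_sum_seq t w _ (iota 0 t)
  (fun i s => wsum (extent s) (subword t s i) (fun k => Phi (t%:Z * k + i%:Z))).
have fi i : i \in iota 0 t ->
    fil t w (fun s => wsum (extent s) (subword t s i) (fun k => Phi (t%:Z * k + i%:Z))).
  rewrite mem_iota add0n => /andP[_ lt_i]; have [q szq Eq] := EPhi i lt_i.
  by apply: fil_ext (fil_class lt_i szq) _ => s _; exact: wsum_eq.
by move=> /(_ fi) F; apply: fil_ext F _ => s _; rewrite wsum_classes.
Qed.

(** Summation along rows raises the degree from k to k + 1, and a class sum weighs one more than its
    degree: hence k + 2. *)
Lemma content_sum_fil t j k : (0 < t)%N -> fil t (k + 2) (content_sum t j k).
Proof.
move=> t0; pose c x : rat := ((x == j%:Z %[mod t%:Z])%Z)%:R.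
pose Phi := antidifference (fun x => c x * x%:~R ^+ k).
have F : fil t (k + 2) (fun s => wsum (t * extent s) (bword s) Phi).
  apply: fil_wsum => // i lt_i; rewrite addn2; apply: (@antidifference_class _ _ c).
    by move=> x y; rewrite /c mulrC modzMDl.
  exact: antidifferenceP.
apply: fil_ext F _ => s sc; have ps := self_conj_part sc.
rewrite -(content_sumE (f := fun x => c x * x%:~R ^+ k) ps) ?leq_pmull //; last first.
  exact: antidifferenceP.
rewrite /content_sum big_mkcond; apply: eq_bigr => b _; rewrite /c.
by case: (_ == _); rewrite ?mul1r ?mul0r.
Qed.

Lemma sum_below K (f Phi : int -> rat) y z : - K%:Z <= z <= K%:Z ->
  (forall x, Phi x - Phi (x - 1) = f x) ->
  \sum_(x <- zr K | x < z) f (y - x) = Phi (y + K%:Z) - Phi (y - z).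
Proof.
move=> zK E; set n := absz (z + K%:Z).
have En : n%:Z = z + K%:Z by rewrite /n; lia.
have le_n : (n <= K + K)%N by lia.
rewrite /zr big_map -(big_filter _ (fun i : nat => i%:Z - K%:Z < z)).
rewrite (eq_filter (a2 := fun i => (i < 0 + n)%N)) ?filter_iota_ltn // => [|i]; last first.
  by clear -En; lia.
rewrite (_ : z = n%:Z - K%:Z); last by rewrite En; ring.
elim: (n) => [|m IH].
  by rewrite big_nil (_ : y - (0 - K%:Z) = y + K%:Z) ?subrr //; ring.
rewrite -addn1 iotaD big_cat big_seq1 /= IH add0n -E.
rewrite (_ : y - (m%:Z - K%:Z) - 1 = y - ((m + 1)%N%:Z - K%:Z)); last by rewrite PoszD; ring.
ring.
Qed.

(** As [f] is even, the pairs with x < y and those with y < x contribute equally; idempotence of [n]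
    evaluates the diagonal. *)
Lemma sum_ordered_pairs K (n : int -> rat) (f : int -> rat) :
  (forall x, f (- x) = f x) -> (forall x, n x * n x = n x) ->
  \sum_(y <- zr K) \sum_(x <- zr K | x < y) n x * n y * f (y - x) =
  2%:R^-1 * (\sum_(y <- zr K) \sum_(x <- zr K) n x * n y * f (y - x)
             - f 0 * \sum_(x <- zr K) n x).
Proof.
move=> even idem; set S := \sum_(y <- _) \sum_(x <- _ | _) _.
have E : \sum_(y <- zr K) \sum_(x <- zr K) n x * n y * f (y - x) =
    S + (S + f 0 * \sum_(x <- zr K) n x).
  have -> : \sum_(y <- zr K) \sum_(x <- zr K) n x * n y * f (y - x) = S +
     \sum_(y <- zr K) \sum_(x <- zr K | ~~ (x < y)) n x * n y * f (y - x).
    by rewrite -big_split; apply: eq_bigr => y _; rewrite (bigID (fun x => x < y)).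
  congr (_ + _).
  have -> : S = \sum_(y <- zr K) \sum_(x <- zr K | y < x) n x * n y * f (y - x).
    rewrite /S (exchange_big_dep predT) //=; apply: eq_bigr => x _; apply: eq_bigr => y _.
    by rewrite -[x - y]opprB even [n x * _]mulrC.
  rewrite mulr_sumr -big_split; apply: eq_big_seq => y yK /=.
  rewrite (bigID (fun x => y < x)) /=; congr (_ + _).
    by apply: eq_bigl => x; case: ltrgtP.
  rewrite -big_filter (_ : filter _ _ = [:: y]).
    by rewrite big_seq1 subrr idem mulrC.
  rewrite (eq_filter (a2 := pred1 y)) => [|x]; last by rewrite /=; case: ltrgtP.
  by rewrite filter_pred1_uniq ?uniq_zr.
by rewrite E; field.
Qed.

(* Hooks are the pairs (1 at x, 0 at y) with x < y.  Writing the indicator n of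
   the 0's as v + e, with v that of the empty partition, the sum is quadratic in e
   and vanishes at e = 0; as f is even, the order condition x < y disappears from
   the quadratic part. *)
Lemma hook_quadratic s K (f Phi : int -> rat) : is_part s -> (extent s <= K)%N ->
  (forall x, f (- x) = f x) -> (forall x, Phi x - Phi (x - 1) = f x) ->
  \sum_(b <- boxes s) f (hook s b)%:Z =
  wsum K (bword s) Phi -
  2%:R^-1 * wsum K (bword s) (fun y => wsum K (bword s) (fun x => f (y - x))).
Proof.
move=> ps le_K even EPhi.
pose n (x : int) : rat := (~~ bword s x)%:R; pose v (x : int) : rat := (x < 0)%R%:R.
pose A (y : int) : rat := \sum_(x <- zr K | x < y) f (y - x).
have idem (b : int -> bool) x : (b x)%:R * (b x)%:R = (b x)%:R :> rat.
  by case: (b x); rewrite ?mulr1 ?mulr0.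
have pairs (m : int -> rat) : (forall x, m x * m x = m x) ->
    \sum_(y <- zr K) \sum_(x <- zr K | x < y) (1 - m x) * m y * f (y - x) =
    \sum_(y <- zr K) m y * A y - 2%:R^-1 *
      (\sum_(y <- zr K) \sum_(x <- zr K) m x * m y * f (y - x) - f 0 * \sum_(x <- zr K) m x).
  move=> idm; rewrite -sum_ordered_pairs // -sumrB; apply: eq_bigr => y _.
  by rewrite /A mulr_sumr -sumrB; apply: eq_bigr => x _; ring.
have Sn : \sum_(b <- boxes s) f (hook s b)%:Z =
   \sum_(y <- zr K) \sum_(x <- zr K | x < y) (1 - n x) * n y * f (y - x).
  rewrite (@big_hooks _ _ _ s 0 K (fun m => f m%:Z) ps) ?addn0 //.
  rewrite big_mkcond; apply: eq_bigr => y _; rewrite subr0 /n; case: (bword s y) => /=.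
    by rewrite big1 // => x _; rewrite mulr0 mul0r.
  rewrite big_mkcondl; apply: eq_bigr => x lt_xy; rewrite subr0.
  rewrite (_ : (absz (y - x))%:Z = y - x); last by lia.
  by case: (bword s x) => /=; ring.
have Sv : \sum_(y <- zr K) \sum_(x <- zr K | x < y) (1 - v x) * v y * f (y - x) = 0.
  apply: big1 => y _; apply: big1 => x lt_xy; rewrite /v.
  have [y0|] := ltrP y 0; last by rewrite mulr0 mul0r.
  by rewrite (lt_trans lt_xy y0) subrr !mul0r.
(* A boundary word has as many 0's in the window as the empty partition. So the diagonal terms with
   [f 0] cancel, and a constant added to [Phi] does not matter. *)
have sum0 : \sum_(x <- zr K) n x = \sum_(x <- zr K) v x.
  have := @wsum_rows s K (fun=> 1) ps le_K; rewrite [RHS]big1 => [|r _]; last by rewrite subrr.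
  rewrite /wsum => E; apply/eqP; rewrite -subr_eq0 -sumrB -[X in _ == X]E; apply/eqP.
  by apply: eq_bigr => x _; rewrite mulr1.
have nn x : n x * n x = n x by exact: (idem (fun x => ~~ bword s x)).
have vv' x : v x * v x = v x by exact: (idem (fun x => x < 0)).
have {Sv} := Sv; rewrite (pairs v vv') => Sv.
rewrite Sn (pairs n nn) -[LHS]subr0 -[X in _ - X = _]Sv.
pose B (y : int) : rat := \sum_(x <- zr K) v x * f (y - x).
(* [A] sums over x < y and [B] over x < 0; both telescope and the window bound cancels, which makes
   [Phi] the coefficient of the linear part. *)
have AB y : y \in zr K -> A y - B y = Phi y - Phi 0.
  rewrite mem_zr => yK; rewrite /A (sum_below y _ EPhi); last by lia.
  have -> : B y = \sum_(x <- zr K | x < 0) f (y - x).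
    rewrite [RHS]big_mkcond; apply: eq_bigr => x _; rewrite /v.
    by case: (x < 0); rewrite ?mul1r ?mul0r.
  by rewrite (sum_below y _ EPhi) ?(subrr y) ?(subr0 y); [ring | lia].
have -> : wsum K (bword s) Phi = \sum_(y <- zr K) (n y - v y) * (A y - B y).
  have -> : \sum_(y <- zr K) (n y - v y) * (A y - B y) =
     \sum_(y <- zr K) (n y - v y) * Phi y - Phi 0 * (\sum_(y <- zr K) n y - \sum_(y <- zr K) v y).
    rewrite -sumrB mulr_sumr -sumrB; apply: eq_big_seq => y yK; rewrite AB //; ring.
  by rewrite sum0 subrr mulr0 subr0.
have -> : wsum K (bword s) (fun y => wsum K (bword s) (fun x => f (y - x))) =
   \sum_(y <- zr K) \sum_(x <- zr K) (n x - v x) * (n y - v y) * f (y - x).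
  by apply: eq_bigr => y _; rewrite mulr_sumr; apply: eq_bigr => x _; rewrite /n /v; ring.
have nv : \sum_(y <- zr K) \sum_(x <- zr K) n x * v y * f (y - x) = \sum_(y <- zr K) n y * B y.
  rewrite exchange_big; apply: eq_bigr => x _; rewrite /B mulr_sumr; apply: eq_bigr => y _.
  by rewrite -[y - x]opprB even mulrA.
have vn : \sum_(y <- zr K) \sum_(x <- zr K) v x * n y * f (y - x) = \sum_(y <- zr K) n y * B y.
  by apply: eq_bigr => x _; rewrite /B mulr_sumr; apply: eq_bigr => y _; ring.
have vv : \sum_(y <- zr K) \sum_(x <- zr K) v x * v y * f (y - x) = \sum_(y <- zr K) v y * B y.
  by apply: eq_bigr => x _; rewrite /B mulr_sumr; apply: eq_bigr => y _; ring.
have -> : \sum_(y <- zr K) \sum_(x <- zr K) (n x - v x) * (n y - v y) * f (y - x) =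
   \sum_(y <- zr K) \sum_(x <- zr K) n x * n y * f (y - x) -
   \sum_(y <- zr K) \sum_(x <- zr K) n x * v y * f (y - x) -
   \sum_(y <- zr K) \sum_(x <- zr K) v x * n y * f (y - x) +
   \sum_(y <- zr K) \sum_(x <- zr K) v x * v y * f (y - x).
  rewrite -!sumrB -big_split; apply: eq_bigr => y _.
  rewrite -!sumrB -big_split; apply: eq_bigr => x _ /=; ring.
rewrite nv vn vv sum0.
have -> : \sum_(y <- zr K) (n y - v y) * (A y - B y) =
   \sum_(y <- zr K) n y * A y - \sum_(y <- zr K) v y * A y
   - \sum_(y <- zr K) n y * B y + \sum_(y <- zr K) v y * B y.
  rewrite -!sumrB -big_split; apply: eq_bigr => y _ /=; ring.
by field.
Qed.

(** On a pair of classes i and j, periodicity makes the coefficient the constant c(i - j), and the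
    binomial theorem separates (y - x)^n. Each product of two class sums has weight (n - a + 1) + (a
    + 1) = n + 2. *)
Lemma fil_quadratic t n (c : int -> rat) : (0 < t)%N ->
    (forall x y, c (t%:Z * y + x) = c x) ->
  fil t (n + 2) (fun s => wsum (t * extent s) (bword s)
    (fun y => wsum (t * extent s) (bword s) (fun x => c (y - x) * (y - x)%:~R ^+ n))).
Proof.
move=> t0 per.
pose l i : {poly rat} := t%:R *: 'X + i%:R%:P.
have szl i m : (size (l i ^+ m)%R <= m.+1)%N.
  apply: (leq_trans (size_poly_exp_leq _ _)).
  have : (size (l i) <= 2)%N.
    rewrite (leq_trans (size_polyD _ _)) // geq_max (leq_trans (size_scale_leq _ _)) ?size_polyX //.
    by rewrite (leq_trans (size_polyC_leq1 _)).
  by case: (size _) => [|[|[|]]] //= _; rewrite ?mul0n ?mul1n.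
have El i k m : (l i ^+ m).[k%:~R] = (t%:Z * k + i%:Z)%:~R ^+ m.
  by rewrite horner_exp /l !hornerE intrD intrM -!pmulrn.
have F : fil t (n + 2) (fun s => \sum_(i <- iota 0 t) \sum_(j <- iota 0 t) \sum_(a < n.+1)
    c (i%:Z - j%:Z) * (-1) ^+ a * 'C(n, a)%:R *
      (class_sum t i (l i ^+ (n - a)) s * class_sum t j (l j ^+ a) s)).
  apply: fil_sum_seq => i; rewrite mem_iota add0n => /andP[_ lt_i].
  apply: fil_sum_seq => j; rewrite mem_iota add0n => /andP[_ lt_j].
  apply: fil_sum => a _; apply: fil_scale.
  apply: fil_mul (fil_class lt_i (szl i (n - a)%N)) (fil_class lt_j (szl j a)) _.
  by have := ltn_ord a; clear; lia.
apply: fil_ext F _ => s _; rewrite wsum_classes //; apply: eq_big_seq => i.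
rewrite mem_iota add0n => /andP[_ lt_i].
transitivity (wsum (extent s) (subword t s i) (fun k => \sum_(j <- iota 0 t) \sum_(a < n.+1)
    c (i%:Z - j%:Z) * (-1) ^+ a * 'C(n, a)%:R * class_sum t j (l j ^+ a) s *
    (l i ^+ (n - a)).[k%:~R])).
  apply: wsum_eq => // k; rewrite wsum_classes //; apply: eq_bigr => j _.
  transitivity (wsum (extent s) (subword t s j) (fun k' => \sum_(a < n.+1)
     c (i%:Z - j%:Z) * (-1) ^+ a * 'C(n, a)%:R * (l i ^+ (n - a)).[k%:~R] * (l j ^+ a).[k'%:~R])).
    apply: wsum_eq => // k'.
    have Ed : t%:Z * k + i%:Z - (t%:Z * k' + j%:Z) = t%:Z * (k - k') + (i%:Z - j%:Z).
      by ring.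
    rewrite [in c _]Ed per.
    rewrite intrB exprBn mulr_sumr; apply: eq_bigr => a _; rewrite !El -mulr_natr; ring.
  by rewrite wsum_sum; apply: eq_bigr => a _; rewrite wsumZ -/(class_sum t j (l j ^+ a) s); ring.
rewrite wsum_sum; apply: eq_bigr => j _; rewrite wsum_sum; apply: eq_bigr => a _.
by rewrite wsumZ -/(class_sum t i (l i ^+ (n - a)) s); ring.
Qed.

Lemma hook_sum_fil t j k : (0 < t)%N -> fil t (2 * k + 2) (hook_sum t j k).
Proof.
move=> t0; pose c x : rat := ((x == j%:Z %[mod t%:Z])%Z || (x == - j%:Z %[mod t%:Z])%Z)%:R.
pose f x := c x * x%:~R ^+ (2 * k).
have per x y : c (t%:Z * y + x) = c x by rewrite /c mulrC !modzMDl.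
(* Taking both signs of j in the congruence makes the indicator even, and the power 2k is even
   too. *)
have even x : f (- x) = f x.
  rewrite /f intrN exprM sqrrN -exprM; congr (_ * _); rewrite /c orbC.
  have neg y z : (- y == z %[mod t%:Z])%Z = (y == - z %[mod t%:Z])%Z.
    by rewrite !eqz_mod_dvd !dvdzE -(abszN (- y - z)); congr (_ %| absz _)%N; ring.
  by rewrite !neg opprK.
pose Phi := antidifference f.
have F1 : fil t (2 * k + 2) (fun s => wsum (t * extent s) (bword s) Phi).
  apply: fil_wsum => // i lt_i; rewrite addn2; apply: (@antidifference_class _ _ c) => //.
  exact: antidifferenceP.
have F2 := fil_scale (- 2%:R^-1) (fil_quadratic (2 * k) t0 per).
apply: fil_ext (fil_add F1 F2) _ => s sc; have ps := self_conj_part sc.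
rewrite mulNr -(hook_quadratic (f := f) ps) ?leq_pmull //; last exact: antidifferenceP.
rewrite /hook_sum big_mkcond; apply: eq_bigr => b _; rewrite /f /c.
by case: (_ || _); rewrite ?mul1r ?mul0r.
Qed.

(** * Iterating the difference operator *)

Lemma binomial_poly_nat j n : (binomial_poly j).[n%:R] = 'C(n, j)%:R.
Proof.
elim: j n => [|j IHj] n.
  by rewrite /binomial_poly hornerZ big_ord0 hornerC fact0 invr1 mul1r bin0.
elim: n => [|n IHn].
  by rewrite /binomial_poly hornerZ horner_prod big_ord_recl hornerXsubC subrr mul0r mulr0 bin0n.
apply/eqP; rewrite -natr1 -subr_eq0 binS natrD -IHj -(binomial_poly_diff j) -IHn; apply/eqP.
ring.
Qed.

(** Only one hook product changes and the exponent N grows by one. The factor 2/t is the probability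
    of a class chosen uniformly among t/2. *)
Lemma G_step t s r i k : step t s r i k -> (i < t./2)%N ->
  G t r = G t s * (2%:R / t%:R *
    ((hook_product (quotient t s i))%:R / (hook_product (quotient t r i))%:R)).
Proof.
move=> S lt_i; rewrite /G.
have iP : i \in index_iota 0 t./2 by rewrite mem_index_iota.
have ui := iota_uniq 0 (t./2 - 0).
have hp_neq0 u : (hook_product u)%:R != 0 :> rat.
  by rewrite pnatr_eq0 -lt0n; apply: prodn_cond_gt0 => b _.
rewrite !(bigD1_seq i iP ui) /= (step_sumn S).
have -> : (\sum_(j <- index_iota 0 t./2 | j != i) sumn (quotient t r j) =
    \sum_(j <- index_iota 0 t./2 | j != i) sumn (quotient t s j))%N.
  rewrite big_seq_cond [RHS]big_seq_cond; apply: eq_bigr => j.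
  by rewrite mem_index_iota => /andP[/andP[_ lt_j] nj]; rewrite (step_quotient S).
have -> : \prod_(j <- index_iota 0 t./2 | j != i) (hook_product (quotient t r j))%:R =
    \prod_(j <- index_iota 0 t./2 | j != i) (hook_product (quotient t s j))%:R :> rat.
  rewrite big_seq_cond [RHS]big_seq_cond; apply: eq_bigr => j.
  by rewrite mem_index_iota => /andP[/andP[_ lt_j] nj]; rewrite (step_quotient S).
rewrite addSn; set P := \prod_(_ <- _ | _) _.
move: (_ + \sum_(_ <- _ | _) _)%N => N; rewrite !exprS.
have := hp_neq0 (quotient t s i); have := hp_neq0 (quotient t r i).
move: (hook_product (quotient t s i))%:R (hook_product (quotient t r i))%:R => a b b0 a0.
rewrite !invfM; move: (t%:R^-1) ((t%:R ^+ N)^-1) (P^-1) => u v w.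
by field; rewrite ?a0 ?b0.
Qed.

Lemma Dt_fil t W g f : ~~ odd t -> (0 < t)%N -> fil t W g ->
    (forall s, self_conj s -> f s = G t s * g s) ->
  exists g', [/\ fil t (W - 2) g', (W < 2)%N -> forall s, self_conj s -> g' s = 0 &
    forall s, self_conj s -> Dt t f s = G t s * g' s].
Proof.
move=> et t0 fg Ef.
pose D i s (k : int) := g (add_strip t s i k) - g s.
exists (fun s => \sum_(i <- iota 0 t./2) (2%:R / t%:R * average t i (D i) s)); split.
- apply: fil_sum_seq => i; rewrite mem_iota add0n => /andP[_ lt_i]; apply: fil_scale.
  by have [] := average_fil (fil_delta fg et lt_i) et lt_i.
- move=> lt_W s sc; apply: big1_seq => i /andP[_]; rewrite mem_iota add0n => /andP[_ lt_i].
  by have [_ ->] := average_fil (fil_delta fg et lt_i) et lt_i; rewrite ?mulr0.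
move=> s sc; have ps := self_conj_part sc.
rewrite /Dt -big_filter (perm_big _ (grow_perm sc et t0)) big_allpairs_dep /= Ef //.
(* The value of g after the move is split into its increment and [g s]. The part with [g s] adds up
   to [G t s * g s], since transitions in a class sum to 1 and t/2 classes carry 2/t each; the
   subtracted [f s] cancels it. *)
have -> : \sum_(i <- iota 0 t./2) \sum_(k <- addable t s i) f (add_strip t s i k) =
   \sum_(i <- iota 0 t./2)
     (G t s * (2%:R / t%:R * average t i (D i) s) + G t s * g s * (2%:R / t%:R)).
  apply: eq_big_seq => i; rewrite mem_iota add0n => /andP[_ lt_i].
  have [M0 _] := moment_log sc et lt_i.
  rewrite -[X in _ + X]mulr1 -[X in _ + _ * X]M0 /moment /average !mulr_sumr -big_split.
  apply: eq_big_seq => k /=; rewrite (mem_addable _ ps (half_lt lt_i)) => /andP[/negbTE ak ak1].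
  have [S _ _] := add_stripP sc et lt_i ak ak1.
  by rewrite Ef ?(step_sc S) // (G_step S lt_i) /transition /D expr0; ring.
rewrite big_split /= -mulr_sumr big_const_seq count_predT size_iota iter_addr_0.
have t_neq0 : t%:R != 0 :> rat by rewrite pnatr_eq0 -lt0n.
have -> : G t s * g s * (2%:R / t%:R) *+ t./2 = G t s * g s.
  rewrite -mulr_natr -mulrA (_ : _ * _%:R = 1) ?mulr1 //.
  by rewrite mulrAC -natrM mul2n even_halfK // divff.
ring.
Qed.

Lemma iter_Dt_fil t W g f r : ~~ odd t -> (0 < t)%N -> fil t W g ->
    (forall s, self_conj s -> f s = G t s * g s) -> (W < 2 * r)%N ->
  forall s, self_conj s -> iter r (Dt t) f s = 0.
Proof.
move=> et t0 fg Ef lt_W.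
(* Truncated subtraction hides the descent below weight 2, so the invariant is an alternative: the
   weight has dropped by 2r, or the function already vanishes. *)
have [w [g' [fg' [le_w|Z] E]]] : exists w g', [/\ fil t w g',
    (w + 2 * r <= W)%N \/ (forall s, self_conj s -> g' s = 0) &
    forall s, self_conj s -> iter r (Dt t) f s = G t s * g' s].
  elim: r {lt_W} => [|r [w [g' [fg' cases E]]]].
    by exists W, g; split=> //; left; rewrite muln0 addn0.
  case: cases => [le_w|Z].
    have [g'' [fg'' Z'' E'']] := Dt_fil et t0 fg' E.
    exists (w - 2)%N, g''; split=> //; have [/Z''|ge_w] := ltnP w 2; [by right|left].
    by move: le_w ge_w; clear; lia.
  have E0 s : self_conj s -> iter r (Dt t) f s = G t s * 0 by move=> sc; rewrite E // Z.
  have [g'' [fg'' Z'' E'']] := Dt_fil et t0 (fil_const t 0 0) E0.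
  by exists (0 - 2)%N, g''; split=> //; right; exact: Z''.
- by move: le_w lt_W; clear; lia.
- by move=> s sc; rewrite E // Z // mulr0.
Qed.

Lemma Dt_sum t n (c : 'I_n -> rat) (h : 'I_n -> seq nat -> rat) s :
  Dt t (fun s => \sum_(j < n) c j * h j s) s = \sum_(j < n) c j * Dt t (h j) s.
Proof.
rewrite /Dt exchange_big -sumrB /=; apply: eq_bigr => j _.
by rewrite -mulr_sumr mulrBr.
Qed.

(** Binomial theorem for the n-th power of 1 + D_t, by Pascal's rule and linearity of D_t. *)
Lemma iter_shift t f n s :
  iter n (fun g s => Dt t g s + g s) f s =
  \sum_(j < n.+1) 'C(n, j)%:R * iter j (Dt t) f s.
Proof.
elim: n s => [|n IH] s; first by rewrite big_ord1 bin0 mul1r.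
rewrite iterS IH.
have -> : Dt t (iter n (fun g s => Dt t g s + g s) f) s =
    Dt t (fun s => \sum_(j < n.+1) 'C(n, j)%:R * iter j (Dt t) f s) s.
  by rewrite /Dt IH; congr (_ - _); apply: eq_bigr => r _; rewrite IH.
rewrite (@Dt_sum t n.+1 (fun j => 'C(n, j)%:R) (fun j => iter j (Dt t) f)).
rewrite [RHS]big_ord_recl /= bin0.
have -> : \sum_(j < n.+1) 'C(n.+1, bump 0 j)%:R * iter (bump 0 j) (Dt t) f s =
    \sum_(j < n.+1) 'C(n, j.+1)%:R * iter j.+1 (Dt t) f s +
    \sum_(j < n.+1) 'C(n, j)%:R * iter j.+1 (Dt t) f s.
  rewrite -big_split; apply: eq_bigr => j _.
  by rewrite /bump add1n binS natrD mulrDl.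
rewrite [X in _ = _ + (X + _)]big_ord_recr /= bin_small // mul0r addr0.
by rewrite [X in _ + X = _]big_ord_recl /= bin0 /bump /=; ring.
Qed.

(** * Path counts and level sums *)

Lemma F_rec_fuel t s' : (0 < t)%N -> forall f f' s, (sumn s <= f)%N -> (sumn s <= f')%N ->
  F_rec f t s s' = F_rec f' t s s'.
Proof.
move=> t0; have nil u f : sumn u = 0%N -> F_rec f t u s' = (u == s').
  case: f => [|f] u0 /=; first by case: eqP.
  case: eqP => //= _; rewrite u0 big1 // => r /and4P[_ /eqP]; lia.
elim=> [|f IH] [|f'] s; rewrite ?leqn0.
- by move=> /eqP s0 _; rewrite !nil.
- by move=> /eqP s0 _; rewrite !nil.
- by move=> _ /eqP s0; rewrite !nil.
move=> le_f le_f' /=; case: eqP => // _; apply: eq_bigr => r /and4P[_ /eqP Esz _ _].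
by apply: IH; lia.
Qed.

Lemma F_refl t s : F t s s = 1%N.
Proof. by rewrite /F; case: (sumn s) => /= [|n]; rewrite eqxx. Qed.

Lemma F_step t s s' : (0 < t)%N -> s != s' ->
  F t s s' = (\sum_(r <- partitions_of (sumn s - 2 * t)
     | [&& self_conj r, sumn s == sumn r + 2 * t, ge_t t s r & ge_t t r s']) F t r s')%N.
Proof.
move=> t0 ne; rewrite {1}/F.
rewrite (F_rec_fuel s' t0 (leqnn _) (leqnSn _)) /= (negPf ne).
apply: eq_bigr => r /and4P[_ /eqP Esz _ _].
by apply: F_rec_fuel => //; lia.
Qed.

Lemma ge_t_trans t a b c : ge_t t a b -> ge_t t b c -> ge_t t a c.
Proof.
case/andP=> /eqP E /allP h1 /andP[E' /allP h2]; rewrite /ge_t E E' /=; apply/allP => i iP.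
apply/sub_partP => j; apply: leq_trans (sub_partP _ _ (h2 i iP) j) _.
exact: (sub_partP _ _ (h1 i iP) j).
Qed.

Lemma ge_t_refl t a : ge_t t a a.
Proof. by rewrite /ge_t eqxx; apply/allP => i _; apply/sub_partP. Qed.

Definition level_sum (t : nat) (mu : seq nat) (n : nat) (f : seq nat -> rat) : rat :=
  \sum_(la <- partitions_of (sumn mu + 2 * n * t) | self_conj la && ge_t t la mu)
     (F t la mu)%:R * f la.

Lemma level_sum0 t mu f : self_conj mu -> ~~ odd t -> (0 < t)%N -> level_sum t mu 0 f = f mu.
Proof.
move=> sc et t0; rewrite /level_sum muln0 mul0n addn0 big_mkcond.
have muP : mu \in partitions_of (sumn mu).
  by rewrite mem_partitions_of (self_conj_part sc) eqxx.
rewrite (bigD1_seq mu muP (uniq_partitions_of _)) /= sc ge_t_refl F_refl mul1r.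
rewrite big_seq_cond big1 ?addr0 // => la /andP[].
rewrite mem_partitions_of => /andP[_ /eqP Esz] ne.
case: andP => // -[scl ge]; case/eqP: ne; exact: (ge_t_eq scl sc et t0 ge Esz).
Qed.

(** [F_step] sums over the last partition before [la]. Exchanging the sums groups level n + 1 by
    this predecessor r, and the sum of f over the successors of r is [Dt t f r + f r]. *)
Lemma level_sumS t mu n f : self_conj mu -> (0 < t)%N ->
  level_sum t mu n.+1 f = level_sum t mu n (fun s => Dt t f s + f s).
Proof.
move=> sc t0; rewrite /level_sum.
transitivity (\sum_(la <- partitions_of (sumn mu + 2 * n.+1 * t) | self_conj la)
   \sum_(r <- partitions_of (sumn mu + 2 * n * t) | [&& self_conj r, ge_t t la r & ge_t t r mu])
     (F t r mu)%:R * f la).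
  rewrite big_mkcond [RHS]big_mkcond; apply: eq_big_seq => la; rewrite mem_partitions_of.
  case/andP=> _ /eqP Esz; case scl : (self_conj la) => //=.
  case: ifPn => ge; last first.
    rewrite big1 // => r /and3P[_ ge1 ge2]; by rewrite (ge_t_trans ge1 ge2) in ge.
  have ne : la != mu by apply: contra_eqN Esz => /eqP->; nia.
  rewrite F_step // (_ : sumn la - 2 * t = sumn mu + 2 * n * t)%N; last by rewrite Esz; nia.
  rewrite natr_sum mulr_suml big_seq_cond [RHS]big_seq_cond; apply: eq_bigl => r.
  rewrite mem_partitions_of; case: eqP => [Er|]; rewrite ?andbF //= andbT.
  by rewrite (_ : sumn la == sumn r + 2 * t)%N //; apply/eqP; rewrite Esz Er; nia.
rewrite (exchange_big_dep (fun r => self_conj r && ge_t t r mu)) /=; last first.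
  by move=> la r _ /and3P[-> _ ->].
rewrite big_seq_cond [RHS]big_seq_cond; apply: eq_bigr => r.
rewrite mem_partitions_of => /andP[/andP[_ /eqP Er] /andP[scr ger]].
rewrite /Dt subrK mulr_sumr
  (_ : sumn r + 2 * t = sumn mu + 2 * n.+1 * t)%N; last by rewrite Er; nia.
by apply: eq_bigl => la; rewrite scr ger andbT.
Qed.

Lemma level_sum_iter t mu n f : self_conj mu -> ~~ odd t -> (0 < t)%N ->
  level_sum t mu n f = iter n (fun g s => Dt t g s + g s) f mu.
Proof.
move=> sc et t0; elim: n f => [|n IH] f; first exact: level_sum0.
by rewrite level_sumS // IH iterSr.
Qed.

Lemma summand_fil t u' v' (j k : 'I_u' -> nat) (j' k' : 'I_v' -> nat) : (0 < t)%N ->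
  exists2 g, fil t (\sum_(u < u') (2 * k u + 2) + \sum_(v < v') (k' v + 2))%N g &
    forall s, summand t j k j' k' s = G t s * g s.
Proof.
move=> t0; exists (fun s => (\prod_(u < u') hook_sum t (j u) (k u) s) *
  \prod_(v < v') content_sum t (j' v) (k' v) s); last by move=> s; rewrite /summand mulrA.
have h := @fil_prod t u' _ _ (fun u => hook_sum_fil (j u) (k u) t0).
have c := @fil_prod t v' _ _ (fun v => content_sum_fil (j' v) (k' v) t0).
exact: fil_mul h c (leqnn _).
Qed.

Theorem theorem5p4 (t : nat) (t_even : ~~ odd t) (t_gt0 : (0 < t)%N)
    (alpha : seq nat) (alpha_sc : self_conj alpha) (alpha_core : is_core t alpha)
    (u' v' : nat) (j k : 'I_u' -> nat) (j' k' : 'I_v' -> nat) :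
  (exists r : nat, forall la : seq nat, self_conj la -> core t la = alpha ->
     iter r (Dt t) (summand t j k j' k') la = 0)
  /\
  (forall mu : seq nat, self_conj mu ->
     exists P : {poly rat},
       ((size P).-1%:R <= \sum_(u < u') (k u + 1)%:R
                          + \sum_(v < v') (k' v + 2)%:R / 2%:R :> rat)
       /\ forall n : nat,
         \sum_(la <- partitions_of (sumn mu + 2 * n * t)
               | self_conj la && ge_t t la mu)
            (F t la mu)%:R * summand t j k j' k' la
         = P.[n%:R]).
Proof.
have [g fg Eg] := summand_fil j k j' k' t_gt0.
(* Half of this weight is the stated bound: a hook factor contributes (2k + 2)/2 = k + 1 and a
   content factor (k' + 2)/2. *)
set W := (_ + _)%N in fg.
have vanish r s : (W./2 < r)%N -> self_conj s -> iter r (Dt t) (summand t j k j' k') s = 0.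
  move=> lt_r; apply: (iter_Dt_fil t_even t_gt0 fg) => //.
  by move: lt_r; clear; lia.
split; first by exists W./2.+1 => la sc _; exact: vanish.
move=> mu sc.
(* Newton form of the polynomial, with the iterated differences at [mu] as coefficients, cut off
   where they vanish. *)
exists (\sum_(i < W./2.+1) iter i (Dt t) (summand t j k j' k') mu *: binomial_poly i); split.
  have -> : \sum_(u < u') (k u + 1)%:R + \sum_(v < v') (k' v + 2)%:R / 2%:R = W%:R / 2%:R :> rat.
    rewrite /W natrD mulrDl !natr_sum !mulr_suml; congr (_ + _).
    by apply: eq_bigr => u _; rewrite (natrD _ (k u)) (natrD _ (2 * k u)) natrM; field.
  rewrite ler_pdivlMr ?ltr0n // -natrM ler_nat.
  set P := \sum_(i < _) _; have szP : (size P <= W./2.+1)%N.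
    apply: (leq_trans (size_sum _ _ _)); apply/bigmax_leqP => i _.
    by apply: (leq_trans (size_scale_leq _ _)); rewrite size_binomial_poly.
  by move: (size P) szP => m; clear; lia.
move=> n; rewrite -/(level_sum t mu n _) level_sum_iter // iter_shift horner_sum.
pose h i : rat := 'C(n, i)%:R * iter i (Dt t) (summand t j k j' k') mu.
(* One sum stops at n, the other at [W./2]. Both extend to a common range, because the binomial
   coefficient vanishes for i > n and the iterated difference for i > [W./2]. *)
have widen m : (m <= n.+1 + W./2.+1)%N -> (forall i, (m <= i)%N -> h i = 0) ->
    \sum_(i < m) h i = \sum_(i < n.+1 + W./2.+1) h i.
  move=> le_m h0; rewrite (big_ord_widen _ h le_m) big_mkcond; apply: eq_bigr => i _.
  by case: ltnP => // /h0->.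
transitivity (\sum_(i < W./2.+1) h i).
  rewrite [LHS](widen n.+1) ?leq_addr // => [|i lt_i]; last by rewrite /h bin_small // mul0r.
  by rewrite -(widen W./2.+1) ?leq_addl // => i lt_i; rewrite /h vanish ?mulr0.
by apply: eq_bigr => i _; rewrite hornerZ binomial_poly_nat mulrC.
Qed.
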